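(* Assume $l=r$. Let $n\ge4$ be an integer and assume that $\mathcal H_{F,r^2}(n)$ is semisimple (equivalently $r^{2k}\neq 1$ for all integers $1\le k\le n$). (i) When $n=4$, the unique proper invariant subspace $K(4)$ of $\mathcal V^{(4)}$ is spanned by the two linearly independent vectors $$w_1^{(4)}=\big(w_{14}-\tfrac1r w_{24}\big)+\big(w_{23}-r\,w_{13}\big),\qquad w_2^{(4)}=\big(w_{24}-\tfrac1r w_{34}\big)+\big(w_{13}-r\,w_{12}\big).$$ (ii) When $n\ge5$, the unique proper invariant subspace $K(n)$ of $\mathcal V^{(n)}$ is the direct sum of the unique proper invariant subspace $K(n-1)$ of $\mathcal V^{(n-1)}$ and of the $(n-2)$-dimensional vector space spanned by the vectors $$w_1^{(n)}=w_{1,n}-\tfrac1r w_{2,n}+r^{n-4}\big(w_{23}-r\,w_{13}\big),$$ $$w_k^{(n)}=w_{k,n}-\tfrac1r w_{k+1,n}+r^{n-4}\big(w_{1,k+1}-r\,w_{1,k}\big),\qquad 2\le k\le n-2 .$$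
   Context: Let $l,r$ be nonzero complex numbers with $r^2\ne1$, $m=\frac1r-r$ and $F=\mathbb{Q}(l,r)\subseteq\mathbb{C}$. The Lawrence--Krammer space $\mathcal V^{(n)}$ is the $F$-vector space with basis $(w_{s,t})_{1\le s<t\le n}$ (also written $w_{st}$); $\mathcal V^{(n-1)}$ is viewed inside $\mathcal V^{(n)}$ as the span of the $w_{s,t}$ with $t\le n-1$. For $1\le i\le n-1$ the generator $g_i$ acts on $\mathcal V^{(n)}$ by the endomorphism $\nu_i$ defined by: - $\nu_i(w_{i,i+1})=\frac1l w_{i,i+1}$; - $\nu_i(w_{s,i})=w_{s,i+1}$ for $s\le i-1$; - $\nu_i(w_{i+1,k})=w_{i,k}+m\,r^{k-i-2}\,w_{i,i+1}-m\,w_{i+1,k}$ for $k\ge i+2$; - $\nu_i(w_{s,i+1})=w_{s,i}+\frac{m}{l\,r^{i-s-1}}\,w_{i,i+1}-m\,w_{s,i+1}$ for $s\le i-1$; - $\nu_i(w_{i,k})=w_{i+1,k}$ for $k\ge i+2$; - $\nu_i(w_{s,k})=r\,w_{s,k}$ in all remaining cases ($\{s,k\}\cap\{i,i+1\}=\emptyset$). An invariant subspace of $\mathcal V^{(n)}$ is a subspace stable under all $\nu_i$, $1\le i\le n-1$; proper means different from $0$ and $\mathcal V^{(n)}$. Put $\nu^{(n)}(g_i)=\nu_i$, $\nu^{(n)}(e_i)=\frac lm(\nu_i^2+m\nu_i-\mathrm{id})$, extended multiplicatively. Let $C_{i,i+1}=e_i$ and $C_{ij}=g_{j-1}^{-1}\cdots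 g_{i+1}^{-1}\,e_i\,g_{i+1}\cdots g_{j-1}$ for $j\ge i+2$, and $K(n)=\bigcap_{1\le i<j\le n}\ker\nu^{(n)}(C_{ij})$. When $l=r$, $n\ge4$ and the semisimplicity assumption holds, $K(n)$ is the unique proper invariant subspace of $\mathcal V^{(n)}$. $\mathcal H_{F,r^2}(n)$ is the Iwahori--Hecke algebra of $Sym(n)$ with parameter $r^2$ over $F$, generated (after rescaling) by $g_1,\dots,g_{n-1}$ with the braid relations and $g_i^2+m\,g_i=1$. *)

(* Defs.v *)
From HB Require Import structures.
From mathcomp Require Import all_boot all_order all_algebra.
From mathcomp Require Import boolp reals complex.

Set Implicit Arguments.
Unset Strict Implicit.
Unset Printing Implicit Defensive.

Import GRing.Theory.
Local Open Scope ring_scope.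
Local Open Scope quotient_scope.

Section GeneratedSubfield.
Variables (C : fieldType) (l r : C).

(* Intersection of all subfields of C containing l and r; it contains Q as soon
   as C has characteristic 0. *)
Definition in_gen_subfield : {pred C} := fun z =>
  `[< forall S : {pred C}, divring_closed S -> l \in S -> r \in S -> z \in S >].

Lemma in_gen_subfieldP z :
  reflect (forall S : {pred C}, divring_closed S ->
             l \in S -> r \in S -> z \in S)
          (z \in in_gen_subfield).
Proof. exact: asboolP. Qed.

Lemma gen_subfield_divring_closed : divring_closed in_gen_subfield.
Proof.
split=> [|x y /in_gen_subfieldP Sx /in_gen_subfieldP Sy
        |x y /in_gen_subfieldP Sx /in_gen_subfieldP Sy];
  apply/in_gen_subfieldP => S Scl lS rS; case: (Scl) => S1 SB SM //.
  by apply: SB; [apply: Sx | apply: Sy].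
by apply: SM; [apply: Sx | apply: Sy].
Qed.

HB.instance Definition _ :=
  GRing.isDivringClosed.Build C in_gen_subfield gen_subfield_divring_closed.

Record gen_subfield := GenSubfield {
  gen_subfield_val :> C;
  gen_subfield_valP : gen_subfield_val \in in_gen_subfield
}.

HB.instance Definition _ := [isSub for gen_subfield_val].
HB.instance Definition _ := [Choice of gen_subfield by <:].
HB.instance Definition _ := [SubChoice_isSubComUnitRing of gen_subfield by <:].
HB.instance Definition _ :=
  [SubComUnitRing_isSubIntegralDomain of gen_subfield by <:].
HB.instance Definition _ :=
  [SubIntegralDomain_isSubField of gen_subfield by <:].

Lemma gen_subfield_l : l \in in_gen_subfield.
Proof. by apply/in_gen_subfieldP. Qed.

Lemma gen_subfield_r : r \in in_gen_subfield.
Proof. by apply/in_gen_subfieldP. Qed.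

Definition genl : gen_subfield := GenSubfield gen_subfield_l.
Definition genr : gen_subfield := GenSubfield gen_subfield_r.

End GeneratedSubfield.

(* The Hecke algebra with parameter r^2 as an algebra given by generators and
   relations: formal expressions modulo the least congruence containing the
   F-algebra laws, the braid relations and g^2 + m g = 1. *)
Section HeckeAlgebra.
Variables (F : fieldType) (r : F) (n : nat).

(* The generator g_i, 1 <= i <= n-1, is [HGen] at the ordinal of value i-1. *)
Inductive hterm :=
  | HConst of F
  | HGen of 'I_n.-1
  | HAdd of hterm & hterm
  | HMul of hterm & hterm.

Inductive hrel : hterm -> hterm -> Prop :=
  | hrel_refl x : hrel x x
  | hrel_sym x y : hrel x y -> hrel y x
  | hrel_trans x y z : hrel x y -> hrel y z -> hrel x z
  | hrel_add x x' y y' :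
      hrel x x' -> hrel y y' -> hrel (HAdd x y) (HAdd x' y')
  | hrel_mul x x' y y' :
      hrel x x' -> hrel y y' -> hrel (HMul x y) (HMul x' y')
  | hrel_addA x y z : hrel (HAdd x (HAdd y z)) (HAdd (HAdd x y) z)
  | hrel_addC x y : hrel (HAdd x y) (HAdd y x)
  | hrel_add0 x : hrel (HAdd (HConst 0) x) x
  | hrel_addN x : hrel (HAdd (HMul (HConst (-1)) x) x) (HConst 0)
  | hrel_mulA x y z : hrel (HMul x (HMul y z)) (HMul (HMul x y) z)
  | hrel_mul1l x : hrel (HMul (HConst 1) x) x
  | hrel_mul1r x : hrel (HMul x (HConst 1)) x
  | hrel_mulDl x y z :
      hrel (HMul (HAdd x y) z) (HAdd (HMul x z) (HMul y z))
  | hrel_mulDr x y z :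
      hrel (HMul x (HAdd y z)) (HAdd (HMul x y) (HMul x z))
  | hrel_constD a b : hrel (HConst (a + b)) (HAdd (HConst a) (HConst b))
  | hrel_constM a b : hrel (HConst (a * b)) (HMul (HConst a) (HConst b))
  | hrel_constC a x : hrel (HMul (HConst a) x) (HMul x (HConst a))
  | hrel_braid (i j : 'I_n.-1) : j = i.+1 :> nat ->
      hrel (HMul (HMul (HGen i) (HGen j)) (HGen i))
           (HMul (HMul (HGen j) (HGen i)) (HGen j))
  | hrel_comm (i j : 'I_n.-1) : (i.+1 < j)%N ->
      hrel (HMul (HGen i) (HGen j)) (HMul (HGen j) (HGen i))
  | hrel_quad (i : 'I_n.-1) :
      hrel (HAdd (HMul (HGen i) (HGen i)) (HMul (HConst (r^-1 - r)) (HGen i)))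
           (HConst 1).

HB.instance Definition _ := gen_eqMixin hterm.
HB.instance Definition _ := gen_choiceMixin hterm.

Definition hrelb (x y : hterm) : bool := `[< hrel x y >].

Lemma hrelb_equiv : equiv_class_of hrelb.
Proof.
split=> [x|x y|y x z].
- by apply/asboolP; apply: hrel_refl.
- by apply/asboolP/asboolP; apply: hrel_sym.
- by move=> /asboolP xy /asboolP yz; apply/asboolP; apply: hrel_trans xy yz.
Qed.

Canonical hrelb_equiv_rel := EquivRelPack hrelb_equiv.

Definition hecke := {eq_quot hrelb}.
HB.instance Definition _ := EqQuotient.on hecke.
HB.instance Definition _ := Choice.on hecke.

Definition hecke_gen (i : 'I_n.-1) : hecke := \pi_hecke (HGen i).
Definition hecke_const (a : F) : hecke := \pi_hecke (HConst a).
Definition hecke_add (x y : hecke) : hecke :=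
  \pi_hecke (HAdd (repr x) (repr y)).
Definition hecke_mul (x y : hecke) : hecke :=
  \pi_hecke (HMul (repr x) (repr y)).
Definition hecke_opp (x : hecke) : hecke := hecke_mul (hecke_const (-1)) x.

Lemma hecke_piP (x y : hterm) :
  hrel x y <-> \pi_hecke x = \pi_hecke y.
Proof. by split=> [xy|/eqmodP/asboolP //]; apply/eqmodP/asboolP. Qed.

Lemma hecke_repr (x : hterm) : hrel (repr (\pi_hecke x)) x.
Proof. by apply/hecke_piP; rewrite reprK. Qed.

Lemma hecke_piD x y :
  \pi_hecke (HAdd x y) = hecke_add (\pi_hecke x) (\pi_hecke y).
Proof.
by apply/hecke_piP/hrel_sym; apply: hrel_add; apply: hecke_repr.
Qed.

Lemma hecke_piM x y :
  \pi_hecke (HMul x y) = hecke_mul (\pi_hecke x) (\pi_hecke y).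
Proof.
by apply/hecke_piP/hrel_sym; apply: hrel_mul; apply: hecke_repr.
Qed.

Lemma hecke_addA : associative hecke_add.
Proof.
elim/quotW=> x; elim/quotW=> y; elim/quotW=> z.
by rewrite -(hecke_piD y z) -(hecke_piD x y) -2!hecke_piD; apply/hecke_piP;
   apply: hrel_addA.
Qed.

Lemma hecke_addC : commutative hecke_add.
Proof.
elim/quotW=> x; elim/quotW=> y.
by rewrite -!hecke_piD; apply/hecke_piP; apply: hrel_addC.
Qed.

Lemma hecke_add0 : left_id (hecke_const 0) hecke_add.
Proof. by elim/quotW=> x; rewrite -hecke_piD; apply/hecke_piP; apply: hrel_add0. Qed.

Lemma hecke_addN : left_inverse (hecke_const 0) hecke_opp hecke_add.
Proof.
elim/quotW=> x.
by rewrite /hecke_opp -hecke_piM -hecke_piD; apply/hecke_piP; apply: hrel_addN.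
Qed.

Lemma hecke_mulA : associative hecke_mul.
Proof.
elim/quotW=> x; elim/quotW=> y; elim/quotW=> z.
by rewrite -(hecke_piM y z) -(hecke_piM x y) -2!hecke_piM; apply/hecke_piP;
   apply: hrel_mulA.
Qed.

Lemma hecke_mul1l : left_id (hecke_const 1) hecke_mul.
Proof. by elim/quotW=> x; rewrite -hecke_piM; apply/hecke_piP; apply: hrel_mul1l. Qed.

Lemma hecke_mul1r : right_id (hecke_const 1) hecke_mul.
Proof. by elim/quotW=> x; rewrite -hecke_piM; apply/hecke_piP; apply: hrel_mul1r. Qed.

Lemma hecke_mulDl : left_distributive hecke_mul hecke_add.
Proof.
elim/quotW=> x; elim/quotW=> y; elim/quotW=> z.
by rewrite -(hecke_piD x y) -(hecke_piM x z) -(hecke_piM y z) -hecke_piM -hecke_piD;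
   apply/hecke_piP; apply: hrel_mulDl.
Qed.

Lemma hecke_mulDr : right_distributive hecke_mul hecke_add.
Proof.
elim/quotW=> x; elim/quotW=> y; elim/quotW=> z.
by rewrite -(hecke_piD y z) -(hecke_piM x y) -(hecke_piM x z) -hecke_piM -hecke_piD;
   apply/hecke_piP; apply: hrel_mulDr.
Qed.

HB.instance Definition _ := GRing.isZmodule.Build hecke
  hecke_addA hecke_addC hecke_add0 hecke_addN.
HB.instance Definition _ := GRing.Zmodule_isPzRing.Build hecke
  hecke_mulA hecke_mul1l hecke_mul1r hecke_mulDl hecke_mulDr.

End HeckeAlgebra.

Definition left_ideal (A : pzRingType) (I : A -> Prop) : Prop :=
  [/\ I 0, (forall x y, I x -> I y -> I (x + y))
    & forall a x, I x -> I (a * x)].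

(* The left regular module is semisimple: every left ideal is a direct
   summand.  For an algebra over a field, left ideals are automatically
   subspaces. *)
Definition semisimple (A : pzRingType) : Prop :=
  forall I : A -> Prop, left_ideal I ->
  exists J : A -> Prop,
    [/\ left_ideal J, (forall x, I x -> J x -> x = 0)
      & forall x, exists y z, [/\ I y, J z & x = y + z]].

(* The pairs (s, t) of natural numbers with 1 <= s < t <= n. *)
Definition lkpair (n : nat) :=
  {p : 'I_n.+1 * 'I_n.+1 | (0 < p.1)%N && (p.1 < p.2)%N}.

Section LawrenceKrammer.
Variables (F : fieldType) (l r : F).

Let m : F := r^-1 - r.

Definition LK (n : nat) := {ffun lkpair n -> F^o}.
HB.instance Definition _ n := Vector.on (LK n).

(* The basis vector w_{s,t}, with 1-based indices; the value is 0 unless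
   1 <= s < t <= n. *)
Definition w (n s t : nat) : LK n :=
  [ffun p : lkpair n =>
     (((val p).1 == s :> nat) && ((val p).2 == t :> nat))%:R : F^o].

Section LinearExtension.
Variables (n : nat) (V : vectType F) (f : nat -> nat -> V).

Definition lin_ext (v : LK n) : V :=
  \sum_(p : lkpair n) v p *: f (val p).1 (val p).2.

Lemma lin_ext_linear : linear lin_ext.
Proof.
move=> a u v; rewrite /lin_ext scaler_sumr -big_split /=.
by apply: eq_bigr => p _; rewrite !ffunE scalerDl scalerA.
Qed.

HB.instance Definition _ :=
  GRing.isLinear.Build F (LK n) V *:%R lin_ext lin_ext_linear.

End LinearExtension.

(* The image of w_{s,t} under nu_i, for 1 <= s < t <= n and 1 <= i <= n-1.
   Because s < t, the tests performed in this order select the cases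
   (s,t) = (i,i+1); t = i; s = i+1; t = i+1 and s < i; s = i and t > i+1;
   {s,t} disjoint from {i,i+1}. *)
Definition nu_w (n i s t : nat) : LK n :=
  if (s == i) && (t == i.+1) then l^-1 *: w n i i.+1
  else if t == i then w n s i.+1
  else if s == i.+1 then
    w n i t + (m * r ^+ (t - i - 2)) *: w n i i.+1 - m *: w n i.+1 t
  else if t == i.+1 then
    w n s i + (m / (l * r ^+ (i - s - 1))) *: w n i i.+1 - m *: w n s i.+1
  else if s == i then w n i.+1 t
  else r *: w n s t.

Definition nu (n i : nat) : 'End(LK n) := linfun (lin_ext (nu_w n i)).

Definition nu_e (n i : nat) : 'End(LK n) :=
  (l / m) *: ((nu n i \o nu n i)%VF + m *: nu n i - \1%VF).

(* nu_C n i d is the image of C_{i,i+1+d}; multiplicativity turns the product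
   g_{j-1}^-1 .. g_{i+1}^-1 e_i g_{i+1} .. g_{j-1} into a composition. *)
Fixpoint nu_C (n i d : nat) : 'End(LK n) :=
  if d is d'.+1 then
    ((nu n (i + d))^-1 \o (nu_C n i d' \o nu n (i + d)))%VF
  else nu_e n i.

Definition K (n : nat) : {vspace LK n} :=
  (\bigcap_(p : lkpair n)
     lker (nu_C n (val p).1 ((val p).2 - (val p).1 - 1)))%VS.

Definition nu_invariant (n : nat) (U : {vspace LK n}) : Prop :=
  forall i : nat, (1 <= i <= n.-1)%N -> (nu n i @: U <= U)%VS.

Definition proper_invariant (n : nat) (U : {vspace LK n}) : Prop :=
  [/\ nu_invariant U, U != 0%VS & U != fullv].

Definition unique_proper_invariant (n : nat) (U : {vspace LK n}) : Prop :=
  proper_invariant U /\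
  forall W : {vspace LK n}, proper_invariant W -> W = U.

(* The identification of V^(p) with a subspace of V^(n) for p <= n, w_{s,t}
   being sent to w_{s,t}. *)
Definition LK_incl (p n : nat) : 'Hom(LK p, LK n) := linfun (lin_ext (w n)).

(* The vectors w_k^(n), 1 <= k <= n-2. *)
Definition wvec (n k : nat) : LK n :=
  w n k n - r^-1 *: w n k.+1 n +
  r ^+ (n - 4) *:
    (if k == 1%N then w n 2 3 - r *: w n 1 3
     else w n 1 k.+1 - r *: w n 1 k).

Definition wspan (n : nat) : {vspace LK n} :=
  <<[seq wvec n k | k <- iota 1 (n - 2)]>>%VS.

End LawrenceKrammer.

(* Main.v *)
(* On V^(n) with l = r, let phi_j be the functional whose value at w_{s,t} is
   r^(t-s-1) if j = s, r^-(t-s-1) if j = t and 0 otherwise. Then e_i x is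
   (phi_i + phi_{i+1})(x) w_{i,i+1}, so K(n) is the common kernel of the phi_j.
   An invariant subspace not contained in K(n) contains some w_{i,i+1}, hence
   everything. On K(n) the generators act by symmetric matrices and
   (g_1 - r)(g_3 - r) is x |-> <v,x> v with v = w_1^(4), which generates K(n); so
   a nonzero invariant subspace of K(n) either contains v, and then K(n), or is
   orthogonal to K(n). The latter is impossible because the Gram matrix of the
   phi_j, all ones plus a diagonal matrix, is invertible when [n-2], [n-1] and [2]
   are nonzero, where [k] = 1 + q + .. + q^(k-1) and q = r^2. Semisimplicity
   makes [1], .., [n] nonzero, since the q-symmetrizer X satisfies
   X^2 = [1]..[n] X. The direct sum is read off the coefficients of w_{1,n}, ..,
   w_{n-1,n}. *)
From HB Require Import structures.
Require Import Defs.
From mathcomp Require Import all_boot all_order all_algebra.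
From mathcomp Require Import boolp functions reals complex.
From mathcomp Require Import ring zify.

Set Implicit Arguments.
Unset Strict Implicit.
Unset Printing Implicit Defensive.

Import GRing.Theory.
Local Open Scope ring_scope.

Definition qint (F : fieldType) (q : F) (k : nat) : F := \sum_(a < k) q ^+ a.

(** * Semisimplicity and quantum integers *)

Section Symmetrizer.
Variables (F : fieldType) (q : F) (V : lmodType F) (t : nat -> {linear V -> V}).
Hypothesis t_quad : forall i x, t i (t i x) = (q - 1) *: t i x + q *: x.
Hypothesis t_braid :
  forall i x, t i (t i.+1 (t i x)) = t i.+1 (t i (t i.+1 x)).
Hypothesis t_comm :
  forall i j x, (i.+1 < j)%N -> t i (t j x) = t j (t i x).

(** The product t_j t_(j+1) .. t_(j+d-1). For d = k - j these are the distinguished representatives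
    of the left cosets of Sym(k) in Sym(k+1). *)
Fixpoint gen_run (j d : nat) (x : V) : V :=
  if d is d'.+1 then t j (gen_run j.+1 d' x) else x.

Definition coset_sum (k : nat) (x : V) : V :=
  \sum_(j < k.+1) gen_run j (k - j) x.

(** The sum of T_u over u in Sym(k), with letters 0, .., k-1, factored along the chain of coset
    representatives. *)
Fixpoint symmetrizer (k : nat) (x : V) : V :=
  if k is k'.+1 then coset_sum k' (symmetrizer k' x) else x.

Lemma gen_runZ j d a x : gen_run j d (a *: x) = a *: gen_run j d x.
Proof. by elim: d j => //= d IHd j; rewrite IHd linearZ. Qed.

Lemma gen_run_comm i j d x :
  (i.+1 < j)%N -> t i (gen_run j d x) = gen_run j d (t i x).
Proof.
elim: d j => //= d IHd j lt_ij; rewrite t_comm // IHd //.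
exact: ltn_trans lt_ij _.
Qed.

(** By the braid relation a generator of the run other than its first one passes through the run
    with its index lowered by one. *)
Lemma gen_run_shift j e d x :
  t (j + e).+1 (gen_run j (e + d.+2) x) = gen_run j (e + d.+2) (t (j + e) x).
Proof.
elim: e j => [|e IHe] j.
  by rewrite addn0 add0n /= -t_braid gen_run_comm.
rewrite addSn /= addnS -t_comm; last by rewrite ltnS ltnS leq_addr.
by rewrite -addSn IHe.
Qed.

(** Each term with j different from i and i+1 is scaled by q. Of the other two, t_i sends the run
    from i+1 to the run from i, and the quadratic relation makes their sum an eigenvector. *)
Lemma coset_sum_inv k y :
    (forall i, (i.+1 < k)%N -> t i y = q *: y) ->
  forall i, (i < k)%N -> t i (coset_sum k y) = q *: coset_sum k y.
Proof.
move=> yinv i lt_ik; rewrite /coset_sum linear_sum scaler_sumr /=.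
pose i0 : 'I_k.+1 := Ordinal (ltnW lt_ik : (i < k.+1)%N).
pose i1 : 'I_k.+1 := Ordinal (lt_ik : (i.+1 < k.+1)%N).
have neq10 : i1 != i0 by rewrite -val_eqE /= neq_ltn ltnSn orbT.
rewrite (bigD1 i0) //= (bigD1 i1) //= [in RHS](bigD1 i0) //=.
rewrite [in RHS](bigD1 i1) //= !addrA; congr (_ + _); last first.
  apply: eq_bigr => j /andP[ji0 ji1].
  have [lt_ji | lt_ij | eq_ji] := ltngtP j i.
  - have [e def_i] : exists e, i = (j + e).+1 by exists (i - j.+1)%N; lia.
    have [d def_k] : exists d, (k - j)%N = (e + d.+2)%N.
      by exists (k - i.+1)%N; lia.
    by rewrite def_k def_i gen_run_shift yinv ?gen_runZ //; lia.
  - have lt_i1j : (i.+1 < j)%N.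
      by rewrite ltn_neqAle lt_ij andbT eq_sym; move: ji1; rewrite -val_eqE.
    rewrite gen_run_comm // yinv ?gen_runZ //; have := ltn_ord j; lia.
  - by move: ji0; rewrite -val_eqE /= eq_ji eqxx.
have -> : (k - i)%N = (k - i.+1).+1 by lia.
by rewrite /= t_quad scalerBl scale1r addrAC subrK.
Qed.

Lemma symmetrizer_inv k x i :
  (i.+1 < k)%N -> t i (symmetrizer k x) = q *: symmetrizer k x.
Proof.
elim: k i => // k IHk i lt_ik.
by apply: coset_sum_inv => // j; apply: IHk.
Qed.

(** On a common eigenvector a run of length d acts by q^d, so each coset sum contributes one quantum
    integer. *)
Lemma symmetrizer_eigen k v :
    (forall i, (i.+1 < k)%N -> t i v = q *: v) ->
  symmetrizer k v = (\prod_(j < k) qint q j.+1) *: v.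
Proof.
elim: k => [|k IHk] vinv /=; first by rewrite big_ord0 scale1r.
rewrite IHk => [|i lt_ik]; last by apply: vinv; apply: ltnW.
have runv d j : (j + d <= k)%N -> gen_run j d v = q ^+ d *: v.
  elim: d j => [|d IHd] j le_jk /=; first by rewrite scale1r.
  rewrite IHd ?addSnnS // linearZZ vinv; last by lia.
  by rewrite scalerA -exprSr.
rewrite big_ord_recr /= -scalerA; set c := \prod_(_ < k) _.
rewrite /coset_sum (eq_bigr (fun j : 'I_k.+1 => c *: (q ^+ (k - j) *: v))).
  rewrite -scaler_sumr -scaler_suml; congr (_ *: (_ *: _)).
  rewrite /qint [RHS](reindex_inj rev_ord_inj) /=; apply: eq_bigr => j _.
  by rewrite subSS.
by move=> j _; rewrite gen_runZ runv // subnKC // -ltnS.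
Qed.

End Symmetrizer.

(** * The action on words by place permutations *)

Section WordAction.
Variables (F : fieldType) (q : F).

Definition swap_at (i : nat) (u : nat -> nat) : nat -> nat :=
  fun j => if j == i then u i.+1 else if j == i.+1 then u i else u j.

(* The place-permutation action on words; when u i = u i.+1 the second branch
   amounts to multiplication by q. *)
Definition word_gen (i : nat) (f : (nat -> nat) -> F^o) : (nat -> nat) -> F^o :=
  fun u => if (u i < u i.+1)%N then q * f (swap_at i u)
           else f (swap_at i u) + (q - 1) * f u.

Lemma word_gen_linear i : linear (word_gen i).
Proof.
move=> a f g; apply/funext => u; rewrite /word_gen !fctE /GRing.scale /=.
by case: ifP => _; ring.
Qed.

HB.instance Definition _ i :=
  GRing.isLinear.Build F _ _ *:%R (word_gen i) (word_gen_linear i).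

Lemma swap_atK i : involutive (swap_at i).
Proof.
move=> u; apply/funext => j; rewrite /swap_at.
by repeat case: eqP => //=; intros; subst; try congr u; lia.
Qed.

Lemma swap_at_id i u : u i = u i.+1 -> swap_at i u = u.
Proof.
move=> e; apply/funext => j; rewrite /swap_at.
by case: eqP => [->//|_]; case: eqP => [->|].
Qed.

Lemma swap_at_comm i j u : (i.+1 < j)%N ->
  swap_at i (swap_at j u) = swap_at j (swap_at i u).
Proof.
move=> lt_ij; apply/funext => k; rewrite /swap_at.
by repeat case: eqP => //=; intros; subst; try congr u; lia.
Qed.

Lemma swap_at_braid i u :
  swap_at i (swap_at i.+1 (swap_at i u)) =
  swap_at i.+1 (swap_at i (swap_at i.+1 u)).
Proof.
apply/funext => k; rewrite /swap_at.
by repeat case: eqP => //=; intros; subst; try congr u; lia.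
Qed.

Lemma swap_at_l i u : swap_at i u i = u i.+1.
Proof. by rewrite /swap_at eqxx. Qed.

Lemma swap_at_r i u : swap_at i u i.+1 = u i.
Proof. by rewrite /swap_at eqxx; case: eqP => // e; lia. Qed.

Lemma swap_at_far i j u : j != i -> j != i.+1 -> swap_at i u j = u j.
Proof. by rewrite /swap_at => /negbTE-> /negbTE->. Qed.

Lemma word_gen_quad i f :
  word_gen i (word_gen i f) = (q - 1) *: word_gen i f + q *: f.
Proof.
apply/funext => u; rewrite !fctE /GRing.scale /= /word_gen.
rewrite swap_atK swap_at_l swap_at_r.
case: ltngtP => // [_|_|e]; [ring | ring | rewrite swap_at_id //; ring].
Qed.

Lemma word_gen_comm i j f : (i.+1 < j)%N ->
  word_gen i (word_gen j f) = word_gen j (word_gen i f).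
Proof.
move=> lt_ij; apply/funext => u; rewrite /word_gen (swap_at_comm u lt_ij).
rewrite (@swap_at_far j i) ?(@swap_at_far j i.+1) ?(@swap_at_far i j)
  ?(@swap_at_far i j.+1); try lia.
by do 2!case: ifP => _ //; ring.
Qed.

Lemma word_gen_braid i f :
  word_gen i (word_gen i.+1 (word_gen i f)) =
  word_gen i.+1 (word_gen i (word_gen i.+1 f)).
Proof.
apply/funext => u; rewrite /word_gen.
have far2 v : swap_at i v i.+2 = v i.+2 by rewrite swap_at_far //; lia.
have far0 v : swap_at i.+1 v i = v i by rewrite swap_at_far //; lia.
do 3!rewrite ?(swap_at_l, swap_at_r, swap_atK, swap_at_braid, far0, far2).
(* Swapping two equal adjacent letters fixes a word; these identities merge values of f that [ring]
   would treat as distinct. *)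
have tie01 : u i = u i.+1 -> swap_at i u = u by exact: swap_at_id.
have tie12 : u i.+1 = u i.+2 -> swap_at i.+1 u = u by exact: swap_at_id.
have tie02 : u i = u i.+2 -> swap_at i (swap_at i.+1 u) = swap_at i.+1 u.
  by move=> e; rewrite swap_at_id // swap_at_l far0.
have tie02' : u i = u i.+2 -> swap_at i.+1 (swap_at i u) = swap_at i u.
  by move=> e; rewrite swap_at_id // swap_at_r far2.
case: (ltngtP (u i) (u i.+1)) => h01; case: (ltngtP (u i.+1) (u i.+2)) => h12;
  case: (ltngtP (u i) (u i.+2)) => h02; try (exfalso; lia);
  rewrite ?(tie02 h02) ?(tie02' h02) ?(tie01 h01) ?(tie12 h12)
    ?(tie02 h02) ?(tie02' h02) ?(tie01 h01) ?(tie12 h12); ring.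
Qed.

Let t (i : nat) : {linear ((nat -> nat) -> F^o) -> ((nat -> nat) -> F^o)} :=
  word_gen i.

Lemma sum_funE m (g : 'I_m -> (nat -> nat) -> F^o) u :
  (\sum_(j < m) g j) u = \sum_(j < m) g j u.
Proof. by elim/big_rec2: _ => // j _ y _ <-. Qed.

(** Supported on the words that agree with the identity from position k on; for k = 0 only the
    identity word is left. *)
Definition supported (k : nat) (f : (nat -> nat) -> F^o) : Prop :=
  forall u j, (k <= j)%N -> u j != j -> f u = 0.

Lemma word_gen_supported k i f :
  (i.+1 < k)%N -> supported k f -> supported k (word_gen i f).
Proof.
move=> lt_ik fS u j le_kj uj; rewrite /word_gen (fS _ j le_kj uj).
rewrite (fS (swap_at i u) j) ?mulr0 ?addr0 ?if_same //.
by rewrite swap_at_far //; lia.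
Qed.

Lemma gen_run_supported k j d f :
  (j + d < k)%N -> supported k f -> supported k (gen_run t j d f).
Proof.
elim: d j => // d IHd j lt_k fS /=; apply: word_gen_supported; first by lia.
by apply: IHd; rewrite // addSnnS.
Qed.

Lemma symmetrizer_supported k f :
  supported 0 f -> supported k (symmetrizer t k f).
Proof.
elim: k => //= k IHk /IHk fS u j lt_kj uj; rewrite /coset_sum sum_funE.
rewrite big1 // => i _; apply: (gen_run_supported (k := k.+1) _ _ lt_kj uj).
  by rewrite subnKC // -ltnS.
by move=> u' j' lt_kj'; apply: fS; apply: ltnW.
Qed.

(** The letter at position j is smaller than all those to its right, so each step takes the first
    branch of [word_gen] and moves that letter one place right; at position k it falls outside the
    support of f. *)
Lemma gen_run_eq0 k j d f u : supported k f -> (j + d)%N = k ->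
  (u j < j)%N -> (forall i, (j < i)%N -> u i = i) -> gen_run t j d f u = 0.
Proof.
move=> fS; elim: d j u => [|d IHd] j u def_k lt_uj u_fix /=.
  by apply: (fS u j); [lia | rewrite neq_ltn lt_uj].
rewrite /word_gen (u_fix j.+1) // (ltn_trans lt_uj) // IHd ?mulr0 //; first by lia.
  by rewrite swap_at_r ltnW.
by move=> i lt_ji; rewrite swap_at_far ?u_fix //; lia.
Qed.

(** At the identity word every coset term but the trivial one vanishes by [gen_run_eq0]. Hence the
    symmetrizer of a delta function is nonzero. *)
Lemma symmetrizer_at_id k f :
  supported 0 f -> symmetrizer t k f id = f id.
Proof.
move=> fS; elim: k => //= k IHk; rewrite /coset_sum sum_funE big_ord_recr /=.
rewrite subnn /= IHk big1 ?add0r // => j _.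
have lt_jk := ltn_ord j; have -> : (k - j)%N = (k - j.+1).+1 by lia.
rewrite /= /word_gen ltnSn (gen_run_eq0 (symmetrizer_supported fS)) ?mulr0 //.
- by lia.
- by rewrite swap_at_r.
- by move=> i lt_ji; rewrite swap_at_far //; lia.
Qed.

Lemma symmetrizer_word_inv k f i : (i.+1 < k)%N ->
  word_gen i (symmetrizer t k f) = q *: symmetrizer t k f.
Proof.
move=> lt_ik.
exact: (symmetrizer_inv word_gen_quad word_gen_braid word_gen_comm).
Qed.

End WordAction.

(** * The Hecke algebra acting on words *)

Section HeckeWordAction.
Variables (F : fieldType) (r : F) (n : nat).
Hypothesis r_neq0 : r != 0.

Let words := (nat -> nat) -> F^o.

(** The factor r^-1 turns T^2 = (q-1) T + q with q = r^2 into g^2 + m g = 1. *)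
Fixpoint word_eval (x : hterm F n) (f : words) : words :=
  match x with
  | HConst a => a *: f
  | HGen i => r^-1 *: word_gen (r ^+ 2) i f
  | HAdd y z => word_eval y f + word_eval z f
  | HMul y z => word_eval y (word_eval z f)
  end.

Lemma word_eval_linear x : linear (word_eval x).
Proof.
elim: x => [c|i|y IHy z IHz|y IHy z IHz] a f g /=.
- by rewrite scalerDr !scalerA mulrC.
- by rewrite linearP scalerDr !scalerA mulrC.
- by rewrite IHy IHz scalerDr addrACA.
- by rewrite IHz IHy.
Qed.

HB.instance Definition _ x :=
  GRing.isLinear.Build F _ _ *:%R (word_eval x) (word_eval_linear x).

Lemma word_eval_hrel x y : hrel r x y -> word_eval x =1 word_eval y.
Proof.
elim=> //=.
- by move=> {}x {}y _ IH f; rewrite IH.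
- by move=> {}x {}y z _ IHx _ IHy f; rewrite IHx.
- by move=> {}x x' {}y y' _ IHx _ IHy f; rewrite IHx IHy.
- by move=> {}x x' {}y y' _ IHx _ IHy f; rewrite IHx IHy.
- by move=> {}x {}y z f; rewrite addrA.
- by move=> {}x {}y f; rewrite addrC.
- by move=> {}x f; rewrite scale0r add0r.
- by move=> {}x f; rewrite scaleN1r addNr scale0r.
- by move=> {}x f; rewrite scale1r.
- by move=> {}x f; rewrite scale1r.
- by move=> {}x {}y z f; rewrite linearD.
- by move=> a b f; rewrite scalerDl.
- by move=> a b f; rewrite scalerA.
- by move=> a {}x f; rewrite linearZ.
- by move=> i j -> f; rewrite !linearZ /= word_gen_braid.
- by move=> i j lt_ij f; rewrite !linearZ /= word_gen_comm.
- move=> i f; rewrite !linearZ /= word_gen_quad !scalerDr !scalerA scale1r.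
  rewrite addrAC -scalerDl.
  rewrite [X in X *: _](_ : _ = 0); last by field.
  rewrite [X in _ + X *: _](_ : _ = 1); last by field.
  by rewrite scale0r add0r scale1r.
Qed.

Definition hecke_act (a : hecke r n) : words -> words := word_eval (repr a).

Lemma hecke_act_pi (x : hterm F n) : hecke_act (\pi_(hecke r n) x)%qT =1 word_eval x.
Proof. by apply: word_eval_hrel; apply: hecke_repr. Qed.

Lemma hecke_actZ a c f : hecke_act a (c *: f) = c *: hecke_act a f.
Proof. exact: linearZ. Qed.

Lemma hecke_actD a b f : hecke_act (a + b) f = hecke_act a f + hecke_act b f.
Proof. exact: hecke_act_pi. Qed.

Lemma hecke_actM a b f : hecke_act (a * b) f = hecke_act a (hecke_act b f).
Proof. exact: hecke_act_pi. Qed.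

Lemma hecke_actC c f : hecke_act (hecke_const r n c) f = c *: f.
Proof. exact: hecke_act_pi. Qed.

Lemma hecke_act_gen i f :
  hecke_act (hecke_gen r i) f = r^-1 *: word_gen (r ^+ 2) i f.
Proof. exact: hecke_act_pi. Qed.

Let t (i : nat) : {linear words -> words} := word_gen (r ^+ 2) i.

(** The symmetrizer is needed as an element of the algebra, so that it can multiply a component of 1
    inside its left ideal. *)
Definition realized (T : words -> words) : Prop :=
  exists a, forall f, hecke_act a f = T f.

Lemma realized_sum m (T : nat -> words -> words) :
  (forall j, (j < m)%N -> realized (T j)) ->
  realized (fun f => \sum_(j < m) T j f).
Proof.
elim: m => [|m IHm] Treal.
  by exists (hecke_const r n 0) => f; rewrite hecke_actC scale0r big_ord0.
have [j lt_jm|a aE] := IHm; first by apply: Treal; apply: ltnW.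
have [b bE] := Treal m (ltnSn m).
by exists (a + b) => f; rewrite hecke_actD aE bE big_ord_recr.
Qed.

Lemma realized_gen_run j d : (j + d < n)%N -> realized (gen_run t j d).
Proof.
elim: d j => [|d IHd] j lt_n.
  by exists (hecke_const r n 1) => f; rewrite hecke_actC scale1r.
have [|a aE] := IHd j.+1; first by lia.
have lt_j : (j < n.-1)%N by lia.
(* The constant r cancels the r^-1 in the action of the generator. *)
exists (hecke_const r n r * (hecke_gen r (Ordinal lt_j) * a)) => f.
by rewrite !hecke_actM hecke_actC hecke_act_gen scalerA mulfV // scale1r aE.
Qed.

Lemma realized_symmetrizer k : (k <= n)%N -> realized (symmetrizer t k).
Proof.
elim: k => [|k IHk] le_kn.
  by exists (hecke_const r n 1) => f; rewrite hecke_actC scale1r.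
have [a aE] := IHk (ltnW le_kn).
have [j lt_jk|b bE] := @realized_sum k.+1 (fun j => gen_run t j (k - j)).
  by apply: realized_gen_run; rewrite subnKC.
by exists (b * a) => f; rewrite hecke_actM aE bE.
Qed.

Lemma hecke_act_eigen a v :
    (forall i : 'I_n.-1, word_gen (r ^+ 2) i v = r ^+ 2 *: v) ->
  exists c, hecke_act a v = c *: v.
Proof.
move=> vinv; rewrite /hecke_act;
elim: (repr a) => /= [c|i|x [c xE] y [d yE]|x [c xE] y [d yE]].
- by exists c.
- by exists (r^-1 * r ^+ 2); rewrite vinv scalerA.
- by exists (c + d); rewrite xE yE scalerDl.
- by exists (d * c); rewrite yE linearZ /= xE scalerA.
Qed.

(* With v = X x0 for the symmetrizer X, let J be a complement of the left ideal
   of the a with a x0 in F v, and write 1 = y + z accordingly. Then X z lies in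
   both ideals, hence v = X y x0 is a multiple of X v = [1]..[n] v. *)
Lemma semisimple_qint_neq0 k :
  semisimple (hecke r n) -> (0 < k <= n)%N -> qint (r ^+ 2) k != 0.
Proof.
move=> ss /andP[k_gt0 le_kn].
pose x0 : words := fun u => (`[< u = id >])%:R.
have x0S : supported 0 x0.
  move=> u j _ uj; rewrite /x0; case: asboolP => // u_id.
  by rewrite u_id eqxx in uj.
pose v := symmetrizer t n x0.
have v_id : v id = 1 by rewrite /v symmetrizer_at_id // /x0 asboolT.
have vinv i : (i.+1 < n)%N -> t i v = r ^+ 2 *: v by exact: symmetrizer_word_inv.
have vinv' (i : 'I_n.-1) : word_gen (r ^+ 2) i v = r ^+ 2 *: v.
  by apply: vinv; have := ltn_ord i; lia.
pose I (a : hecke r n) := exists c, hecke_act a x0 = c *: v.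
have idI : left_ideal I.
  split=> [|a b [c ac] [d bd]|a b [c bc]].
  - by exists 0; rewrite (hecke_actC 0) !scale0r.
  - by exists (c + d); rewrite hecke_actD ac bd scalerDl.
  - have [d av] := hecke_act_eigen a vinv'.
    by exists (c * d); rewrite hecke_actM bc hecke_actZ av scalerA.
have [J [[_ _ JM] IJ dec]] := ss I idI.
have [y [z [[c yc] Jz yz]]] := dec 1.
have [X XE] := realized_symmetrizer (leqnn n).
have vE : hecke_act (X * y) x0 + hecke_act (X * z) x0 = v.
  by rewrite -hecke_actD -mulrDr -yz mulr1 XE.
set s := \prod_(j < n) qint (r ^+ 2) j.+1.
have XyE : hecke_act (X * y) x0 = (c * s) *: v.
  by rewrite hecke_actM yc hecke_actZ XE (symmetrizer_eigen vinv) scalerA.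
have Xz0 : X * z = 0.
  apply: IJ (JM X z Jz); exists (1 - c * s).
  by rewrite scalerBl scale1r -{1}vE XyE addrC addKr.
have: c * s = 1.
  move: vE; rewrite XyE Xz0 (hecke_actC 0) scale0r addr0 => /(congr1 (fun f => f id)).
  by rewrite !fctE v_id /GRing.scale /= mulr1.
move=> cs1; have s_neq0 : s != 0.
  by apply: contra_eq_neq cs1 => ->; rewrite mulr0 eq_sym oner_neq0.
have lt_kn : (k.-1 < n)%N by lia.
have := prodf_neq0 _ _ s_neq0 (Ordinal lt_kn) isT.
by rewrite /= prednK.
Qed.

End HeckeWordAction.
(** * The Lawrence-Krammer space for l = r *)

Section Coordinates.
Variables (F : fieldType) (n : nat).
Implicit Types (x y : LK F n).

Lemma lk_sum x : x = \sum_p x p *: w F n (val p).1 (val p).2.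
Proof.
apply/ffunP => p; rewrite sum_ffunE (bigD1 p) //= big1 => [|q neq_qp].
  by rewrite addr0 !ffunE !eqxx /GRing.scale /= mulr1.
rewrite !ffunE /GRing.scale /=; case: andP => [[/eqP e1 /eqP e2]|_]; last exact: mulr0.
case/eqP: neq_qp; apply: val_inj; rewrite [RHS]surjective_pairing [LHS]surjective_pairing.
by congr (_, _); apply: val_inj.
Qed.

Lemma lkpair_ex s t : (0 < s < t)%N -> (t <= n)%N ->
  exists p : lkpair n, (val p).1 = s :> nat /\ (val p).2 = t :> nat.
Proof.
move=> st le_tn; pose p0 : 'I_n.+1 * 'I_n.+1 := (inord s, inord t).
have vs : val p0.1 = s by rewrite /= inordK //; lia.
have vt : val p0.2 = t by rewrite /= inordK //; lia.
have p0P : (0 < p0.1)%N && (p0.1 < p0.2)%N by rewrite vs vt.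
by exists (Sub p0 p0P); rewrite SubK.
Qed.

Lemma lin_ext_w (V : vectType F) (f : nat -> nat -> V) s t :
  (0 < s < t)%N -> (t <= n)%N -> lin_ext f (w F n s t) = f s t.
Proof.
move=> st le_tn; have [p [<- <-]] := lkpair_ex st le_tn.
rewrite /lin_ext (bigD1 p) //= big1 => [|q neq_qp].
  by rewrite !ffunE !eqxx scale1r addr0.
rewrite !ffunE; case: andP => [[/eqP e1 /eqP e2]|_]; last exact: scale0r.
case/eqP: neq_qp; apply: val_inj; rewrite [RHS]surjective_pairing.
by rewrite [LHS]surjective_pairing; congr (_, _); apply: val_inj.
Qed.

Lemma lk_ind (P : LK F n -> Prop) :
    P 0 -> (forall a x y, P x -> P y -> P (a *: x + y)) ->
    (forall s t, (0 < s < t)%N -> (t <= n)%N -> P (w F n s t)) ->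
  forall x, P x.
Proof.
move=> P0 PD Pw x; rewrite (lk_sum x); elim/big_rec: _ => // p y _ Py.
apply: PD => //; apply: Pw; first exact: (valP p).
by rewrite -ltnS ltn_ord.
Qed.

(** Indexed by plain naturals and linear by construction; outside 1 <= s < t <= n its value is 0. *)
Definition entry (s t : nat) x : F :=
  lin_ext (fun a b => ((a == s) && (b == t))%:R : F^o) x.

Lemma entryP s t a x y : entry s t (a *: x + y) = a * entry s t x + entry s t y.
Proof. by rewrite /entry linearP. Qed.
Lemma entry0 s t : entry s t 0 = 0.
Proof. by rewrite /entry linear0. Qed.
Lemma entryD s t x y : entry s t (x + y) = entry s t x + entry s t y.
Proof. by rewrite /entry linearD. Qed.
Lemma entryB s t x y : entry s t (x - y) = entry s t x - entry s t y.
Proof. by rewrite /entry linearB. Qed.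
Lemma entryN s t x : entry s t (- x) = - entry s t x.
Proof. by rewrite /entry linearN. Qed.
Lemma entryZ s t a x : entry s t (a *: x) = a * entry s t x.
Proof. by rewrite /entry linearZ. Qed.
Lemma entry_sum (I : Type) (s : seq I) (P : pred I) (g : I -> LK F n) a b :
  entry a b (\sum_(i <- s | P i) g i) = \sum_(i <- s | P i) entry a b (g i).
Proof. by rewrite /entry linear_sum. Qed.

Lemma w_out s t : ~~ ((0 < s < t) && (t <= n))%N -> w F n s t = 0.
Proof.
move=> st; apply/ffunP => p; rewrite !ffunE; case: andP => // -[/eqP e1 /eqP e2].
by case/negP: st; rewrite -e1 -e2 (valP p) /= -ltnS ltn_ord.
Qed.

Lemma entry_w s t a b : (0 < s < t)%N -> (t <= n)%N ->
  entry s t (w F n a b) = ((a == s) && (b == t))%:R.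
Proof.
move=> st le_tn; have [/andP[ab le_bn]|ab] := boolP ((0 < a < b) && (b <= n))%N.
  by rewrite /entry lin_ext_w.
rewrite w_out // entry0; case: andP => // -[/eqP as_ /eqP bt].
by rewrite as_ bt st le_tn in ab.
Qed.

Lemma entry_out s t x : ~~ ((0 < s < t) && (t <= n))%N -> entry s t x = 0.
Proof.
move=> st; rewrite /entry /lin_ext big1 // => p _.
case: andP => [[/eqP e1 /eqP e2]|_]; last exact: scaler0.
by case/negP: st; rewrite -e1 -e2 (valP p) /= -ltnS ltn_ord.
Qed.

Lemma entry_pair x (p : lkpair n) : entry (val p).1 (val p).2 x = x p.
Proof.
elim/lk_ind: x => [|a x y xE yE|s t st le_tn]; first by rewrite entry0 ffunE.
  by rewrite entryP xE yE !ffunE.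
rewrite entry_w ?(valP p) //; last by rewrite -ltnS ltn_ord.
by rewrite ffunE eq_sym [t == _]eq_sym.
Qed.

Lemma lk_eqP x y :
  (forall s t, (0 < s < t)%N -> (t <= n)%N -> entry s t x = entry s t y) -> x = y.
Proof.
move=> xy; apply/ffunP => p; rewrite -!entry_pair; apply: xy.
  exact: (valP p).
by rewrite -ltnS ltn_ord.
Qed.

End Coordinates.

Definition entryE := (entryN, entryB, entryD, entryZ, entry0).

Ltac kron :=
  repeat (match goal with |- context [@eq_op _ ?a ?b] =>
    destruct (@eqP _ a b) end; try (exfalso; lia)); rewrite /=; subst.

(** * The functionals phi_j and the matrix entries of the generators *)

Section LKForm.
Variables (F : fieldType) (r : F) (n : nat).
Hypothesis r_neq0 : r != 0.
Implicit Types (x y : LK F n).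

Let m : F := r^-1 - r.
Local Notation w := (w F n).
Local Notation nu := (nu r r n).

Definition wt (s t : nat) : F := r ^+ (t - s - 1).

Lemma wt_neq0 s t : wt s t != 0.
Proof. by rewrite expf_neq0. Qed.

Lemma wt1 s : wt s s.+1 = 1.
Proof. by rewrite /wt subSnn. Qed.

Lemma wtSr s t : (s < t)%N -> wt s t.+1 = r * wt s t.
Proof. by move=> lt_st; rewrite /wt -exprS; congr (_ ^+ _); lia. Qed.

Lemma wtSl s t : (s.+1 < t)%N -> wt s t = r * wt s.+1 t.
Proof. by move=> lt_st; rewrite /wt -exprS; congr (_ ^+ _); lia. Qed.

Definition phi (j : nat) x : F :=
  lin_ext (fun s t => (j == s)%:R * wt s t + (j == t)%:R / wt s t : F^o) x.

Lemma phiP j a x y : phi j (a *: x + y) = a * phi j x + phi j y.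
Proof. by rewrite /phi linearP. Qed.
Lemma phi0 j : phi j 0 = 0.
Proof. by rewrite /phi linear0. Qed.
Lemma phiD j x y : phi j (x + y) = phi j x + phi j y.
Proof. by rewrite /phi linearD. Qed.
Lemma phiB j x y : phi j (x - y) = phi j x - phi j y.
Proof. by rewrite /phi linearB. Qed.
Lemma phiZ j a x : phi j (a *: x) = a * phi j x.
Proof. by rewrite /phi linearZ. Qed.
Lemma phi_w j s t : (0 < s < t)%N -> (t <= n)%N ->
  phi j (w s t) = (j == s)%:R * wt s t + (j == t)%:R / wt s t.
Proof. by move=> st le_tn; rewrite /phi lin_ext_w. Qed.

Lemma nu_wE i s t : (0 < s < t)%N -> (t <= n)%N -> nu i (w s t) = nu_w r r n i s t.
Proof. by move=> st le_tn; rewrite lfunE /= lin_ext_w. Qed.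

Local Ltac fld := rewrite /m; (ring || field); rewrite ?oner_neq0 ?r_neq0 ?wt_neq0 //.

Variant lk_case (i s t : nat) : LK F n -> Type :=
  | LkSame of s = i & t = i.+1 : lk_case i s t (r^-1 *: w i i.+1)
  | LkUpR of (s < i)%N & t = i : lk_case i s t (w s i.+1)
  | LkDownL of s = i.+1 & (i.+1 < t)%N :
      lk_case i s t (w i t + (m * wt i.+1 t) *: w i i.+1 - m *: w i.+1 t)
  | LkDownR of (s < i)%N & t = i.+1 :
      lk_case i s t (w s i + (m / (r * wt s i)) *: w i i.+1 - m *: w s i.+1)
  | LkUpL of s = i & (i.+1 < t)%N : lk_case i s t (w i.+1 t)
  | LkFar of s != i & s != i.+1 & t != i & t != i.+1 : lk_case i s t (r *: w s t).

Lemma nuP i s t : (0 < i < n)%N -> (0 < s < t)%N -> (t <= n)%N ->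
  lk_case i s t (nu i (w s t)).
Proof.
move=> lt_in st le_tn; rewrite nu_wE // /nu_w.
case: (eqVneq s i) => [si|si]; case: (eqVneq t i.+1) => [ti1|ti1] /=.
- by rewrite si; apply: LkSame.
- have -> : (t == i) = false by lia. have -> : (s == i.+1) = false by lia.
  by rewrite si; apply: LkUpL; lia.
- have -> : (t == i) = false by lia. have -> : (s == i.+1) = false by lia.
  by apply: LkDownR; lia.
case: (eqVneq t i) => [ti|ti]; first by apply: LkUpR; lia.
case: (eqVneq s i.+1) => [si1|si1]; last by apply: LkFar.
have -> : (t - i - 2 = t - i.+1 - 1)%N by lia.
by rewrite si1; apply: LkDownL; lia.
Qed.

(* The entries of the image under g_i, seen as an operator of the permutation
   module on two-element subsets. *)
Definition perm_entry (i : nat) (c : nat -> nat -> F) (s t : nat) : F :=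
  if (s == i) && (t == i.+1) then r * c s t
  else if t == i then c s i.+1
  else if s == i.+1 then c i t - m * c i.+1 t
  else if t == i.+1 then c s i - m * c s i.+1
  else if s == i then c i.+1 t
  else r * c s t.

(** The transpose of g_i permutes the phi_j up to scalars, so their common kernel is invariant. *)
Lemma phi_nu i j x : (0 < i < n)%N -> phi j (nu i x) =
  if j == i then r^-1 * phi i.+1 x
  else if j == i.+1 then r^-1 * phi i x else r * phi j x.
Proof.
move=> lt_in; elim/lk_ind: x => [|a x y xE yE|s t st le_tn].
- by rewrite linear0 !phi0 !mulr0 !if_same.
- by rewrite linearP /= !phiP xE yE; case: ifP => _; [|case: ifP => _]; ring.
case: nuP => // [e1 e2|e1 e2|e1 e2|e1 e2|e1 e2|e1 e2 e3 e4]; subst=> //;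
  rewrite ?(phiB, phiD, phiZ) !phi_w; try lia; rewrite ?wt1.
- kron; fld.
- rewrite wtSr //; kron; fld.
- rewrite [wt i t]wtSl //; kron; fld.
- rewrite wtSr //; kron; fld.
- rewrite [wt i t]wtSl //; kron; fld.
- kron; fld.
Qed.

(** For l = r the generator is the permutation-module operator plus a rank-one correction along
    w_{i,i+1}, which vanishes on the common kernel of the phi_j. *)
Lemma entry_nu i x s t : (0 < i < n)%N -> (0 < s < t)%N -> (t <= n)%N ->
  entry s t (nu i x) = perm_entry i (fun a b => entry a b x) s t
    + m * phi i.+1 x * ((s == i) && (t == i.+1))%:R.
Proof.
move=> lt_in st le_tn; elim/lk_ind: x => [|a x y xE yE|a b ab le_bn].
- by rewrite linear0 entry0 phi0 mulr0 mul0r addr0 /perm_entry !entry0;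
  repeat case: ifP => _; ring.
- rewrite linearP /= entryP phiP xE yE /perm_entry !entryP.
  by repeat case: ifP => _; ring.
rewrite phi_w // /perm_entry.
have wtr : (a < i)%N -> wt a i.+1 = r * wt a i by exact: wtSr.
case: nuP => // [e1 e2|e1 e2|e1 e2|e1 e2|e1 e2|e1 e2 e3 e4]; subst=> //;
  rewrite ?wt1 ?wtr //; clear wtr; kron;
  rewrite ?entryE ?entry_w; try lia; kron; fld.
Qed.

End LKForm.

(** * K(n) as the common kernel of the phi_j *)

Section PhiKernel.
Variables (F : fieldType) (r : F) (n : nat).
Hypotheses (r_neq0 : r != 0) (r2_neq1 : r ^+ 2 != 1).
Implicit Types (x y : LK F n).

Let m : F := r^-1 - r.
Local Notation w := (w F n).
Local Notation nu := (nu r r n).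
Local Notation phi := (phi r).

Local Ltac fld :=
  rewrite /m; (ring || field); rewrite ?oner_neq0 ?r_neq0 ?wt_neq0 //.

Lemma mixing_neq0 : m != 0.
Proof.
apply: contraNneq r2_neq1 => m0; rewrite -subr_eq0 -oppr_eq0.
have -> : - (r ^+ 2 - 1) = r * m by rewrite /m; field.
by rewrite m0 mulr0.
Qed.

Lemma w_neq0 s t : (0 < s < t)%N -> (t <= n)%N -> w s t != 0.
Proof.
move=> st le_tn; apply/eqP => /(congr1 (entry s t)).
by rewrite entry_w // entry0 !eqxx => /eqP; rewrite oner_eq0.
Qed.

(** With w = w_{i,i+1}, the permutation part P satisfies P^2 + m P = 1 and P w = r w, and phi_(i+1)
    g_i = r^-1 phi_i. So g_i^2 + m g_i - 1 reduces to m (r^-1 phi_i + (r + m) phi_(i+1)) w, where r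
    + m = r^-1. *)
Lemma nu_eE i x : (0 < i < n)%N ->
  nu_e r r n i x = (phi i x + phi i.+1 x) *: w i i.+1.
Proof.
move=> lt_in; have m0 := mixing_neq0; have m0' : 1 - r ^+ 2 != 0.
  by rewrite subr_eq0 eq_sym.
apply: lk_eqP => s t st le_tn.
rewrite /nu_e scale_lfunE !add_lfunE opp_lfunE scale_lfunE comp_lfunE id_lfunE.
rewrite !entryE entry_w // entry_nu // [entry s t (nu i x)]entry_nu // phi_nu //.
rewrite /perm_entry; kron; rewrite ?entry_nu; try lia; rewrite /perm_entry.
all: kron; fld; by rewrite /= mulNr -expr2.
Qed.

(** A kernel vector x has e_i x = -(r/m) x, so it is a multiple of w_{i,i+1}, which g_i scales by
    r^-1. Injectivity makes the inverses in C_{ij} genuine. *)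
Lemma nu_inj i : (0 < i < n)%N -> lker (nu i) == 0%VS.
Proof.
move=> lt_in; rewrite -subv0; apply/subvP => x; rewrite memv_ker memv0.
move=> /eqP nux0; have := nu_eE x lt_in.
rewrite /nu_e scale_lfunE !add_lfunE opp_lfunE scale_lfunE comp_lfunE id_lfunE.
rewrite nux0 linear0 scaler0 !add0r; set c := phi i x + _ => xE.
have {}xE : x = (- (m / r) * c) *: w i i.+1.
  have mr : - (m / r) * (r / m) = -1.
    by have := mixing_neq0; move: m => m' m'_neq0; field; rewrite m'_neq0.
  by rewrite -scalerA -xE scalerA mr scaleN1r opprK.
move: nux0; rewrite xE linearZ /= nu_wE ?ltnS ?leqnn /nu_w ?eqxx /=; try lia.
by rewrite scalerA => /eqP; rewrite !scaler_eq0 mulf_eq0 invr_eq0 (negbTE r_neq0) orbF.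
Qed.

Definition phi_free : {pred LK F n} :=
  fun x => [forall j : 'I_n.+1, (0 < j)%N ==> (phi j x == 0)].

Lemma phi_freeP x :
  reflect (forall j, (0 < j <= n)%N -> phi j x = 0) (x \in phi_free).
Proof.
apply: (iffP 'forall_implyP) => xP j.
  by case/andP => j_gt0 le_jn; apply/eqP/(xP (Ordinal (le_jn : (j < n.+1)%N))).
by move=> j_gt0; apply/eqP/xP; rewrite j_gt0 -ltnS ltn_ord.
Qed.

Lemma phi_free0 : 0 \in phi_free.
Proof. by apply/phi_freeP => j _; rewrite phi0. Qed.

Lemma phi_free_lin a x y :
  x \in phi_free -> y \in phi_free -> a *: x + y \in phi_free.
Proof.
move=> /phi_freeP xP /phi_freeP yP; apply/phi_freeP => j jP.
by rewrite phiP xP // yP // mulr0 addr0.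
Qed.

Lemma phi_free_nu i x : (0 < i < n)%N -> x \in phi_free -> nu i x \in phi_free.
Proof.
move=> lt_in /phi_freeP xP; apply/phi_freeP => j jP; rewrite phi_nu //.
by case: ifP => _; [|case: ifP => _]; rewrite xP ?mulr0 //; lia.
Qed.

Lemma phi_free_nu_C i d x :
  (0 < i)%N -> (i + d < n)%N -> x \in phi_free -> nu_C r r n i d x = 0.
Proof.
move=> i_gt0; elim: d x => [|d IHd] x lt_in xP /=.
  rewrite addn0 in lt_in; move/phi_freeP: xP => xP.
  by rewrite nu_eE ?i_gt0 // !xP ?addr0 ?scale0r //; lia.
by rewrite !comp_lfunE IHd ?linear0 //; [lia | apply: phi_free_nu => //; lia].
Qed.

(* The values of e_i and of nu_(i+1)^-1 e_i nu_(i+1) give phi_i = - phi_(i+1) and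
   r^2 phi_i = - phi_(i+2). *)
Lemma phi_free_of_e x : (2 < n)%N -> 1 + r ^+ 2 != 0 ->
    (forall i, (0 < i < n)%N -> phi i x + phi i.+1 x = 0) ->
    phi 1 (nu 2 x) + phi 2 (nu 2 x) = 0 ->
  x \in phi_free.
Proof.
move=> n_gt2 q1 e0; rewrite !phi_nu //= => e1.
have phi10 : phi 1 x = 0.
  have e12 : phi 2 x = - phi 1 x by apply/eqP; rewrite -addr_eq0 addrC e0 //; lia.
  have e23 : phi 3 x = - phi 2 x by apply/eqP; rewrite -addr_eq0 addrC e0.
  apply/eqP; move: e1; rewrite e23 e12 opprK => e1.
  have: (1 + r ^+ 2) * phi 1 x = r * (r * phi 1 x + r^-1 * phi 1 x) by field.
  by rewrite e1 mulr0 => /eqP; rewrite mulf_eq0 (negbTE q1).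
apply/phi_freeP; elim=> // -[//|j] IHj lt_jn; have := e0 j.+1.
rewrite IHj ?add0r; last by lia.
by apply; lia.
Qed.

(** The e_i and C_{13} force every phi_j to vanish; conversely the common kernel is stable under the
    g_i and killed by the e_i, hence by every C_{ij}. *)
Lemma memK x : (2 < n)%N -> 1 + r ^+ 2 != 0 -> (x \in K r r n) = (x \in phi_free).
Proof.
move=> n_gt2 q1; apply/idP/idP => [|xP].
  rewrite memvE => /subv_bigcapP xK.
  have xC i d : (0 < i)%N -> (i + d < n)%N -> nu_C r r n i d x = 0.
    move=> i_gt0 lt_n; pose p0 : 'I_n.+1 * 'I_n.+1 := (inord i, inord (i + d).+1).
    have e1 : val p0.1 = i by rewrite /= inordK //; lia.
    have e2 : val p0.2 = (i + d).+1 by rewrite /= inordK //; lia.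
    have p0P : (0 < p0.1)%N && (p0.1 < p0.2)%N by rewrite e1 e2; lia.
    have := xK (Sub p0 p0P) isT; rewrite SubK e1 e2 -memvE memv_ker.
    by rewrite (_ : (_ - _ - 1 = d)%N) => [/eqP|]; last by lia.
  have nz i : (0 < i < n)%N -> w i i.+1 != 0 by move=> lt_in; apply: w_neq0; lia.
  apply: phi_free_of_e => // [i lt_in|].
    have /eqP := xC i 0 ltac:(lia) ltac:(lia).
    by rewrite /= nu_eE // scaler_eq0 (negbTE (nz i lt_in)) orbF => /eqP.
  (* C_{13} = g_2^-1 e_1 g_2: applying g_2 removes the inverse and leaves e_1 g_2 x = 0. *)
  have /(congr1 (nu 2)) := xC 1 1 isT n_gt2.
  rewrite /= !comp_lfunE linear0 lker0_lfunVK ?nu_inj //.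
  have nz1 : w 1 2 != 0 by apply: nz; lia.
  rewrite nu_eE; last lia.
  by move/eqP; rewrite scaler_eq0 (negbTE nz1) orbF => /eqP.
rewrite memvE; apply/subv_bigcapP => p _; rewrite -memvE memv_ker.
have := valP p; have := ltn_ord (val p).2; rewrite /= => lt2 /andP[p_gt0 lt12].
by rewrite phi_free_nu_C //; lia.
Qed.

(** The symmetric form for which the w_{s,t} are orthonormal. *)
Definition dot x y : F := \sum_p x p * y p.

Lemma dotP a x y z : dot z (a *: x + y) = a * dot z x + dot z y.
Proof.
rewrite /dot mulr_sumr -big_split; apply: eq_bigr => p _ /=.
by rewrite !ffunE /GRing.scale /=; ring.
Qed.

Lemma dotC x y : dot x y = dot y x.
Proof. by apply: eq_bigr => p _; rewrite mulrC. Qed.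

Lemma dot_w x s t : dot x (w s t) = entry s t x.
Proof. by apply: eq_bigr => p _; rewrite !ffunE. Qed.

Lemma dot0 x : dot x 0 = 0.
Proof. by rewrite /dot big1 // => p _; rewrite ffunE mulr0. Qed.

Lemma dotD z x y : dot z (x + y) = dot z x + dot z y.
Proof. by rewrite -[x]scale1r dotP scale1r mul1r. Qed.

Lemma dotZ z a x : dot z (a *: x) = a * dot z x.
Proof. by rewrite -[a *: x]addr0 dotP dot0 addr0. Qed.

Lemma dotB z x y : dot z (x - y) = dot z x - dot z y.
Proof. by rewrite -scaleN1r dotD dotZ mulN1r. Qed.

(* On the common kernel of the phi_j the generator nu_i acts by a symmetric matrix. *)
Lemma dot_nu i x y : (0 < i < n)%N ->
  dot (nu i x) y - m * phi i.+1 x * entry i i.+1 y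
  = dot x (nu i y) - m * phi i.+1 y * entry i i.+1 x.
Proof.
move=> lt_in; elim/lk_ind: y => [|a y z yE zE|s t st le_tn].
- by rewrite linear0 !dot0 phi0 entry0; ring.
- rewrite linearP /= !dotP phiP entryP.
  rewrite (_ : _ - _ = a * (dot (nu i x) y - m * phi i.+1 x * entry i i.+1 y)
    + (dot (nu i x) z - m * phi i.+1 x * entry i i.+1 z)); last by ring.
  by rewrite yE zE; ring.
rewrite dot_w entry_nu // entry_w; try lia.
rewrite phi_w // /perm_entry.
have wtr : (s < i)%N -> wt r s i.+1 = r * wt r s i by exact: wtSr.
case: (nuP r_neq0 lt_in st) => // [e1 e2|e1 e2|e1 e2|e1 e2|e1 e2|e1 e2 e3 e4]; subst=> //;
  rewrite ?wt1 ?wtr //; clear wtr; rewrite ?(dotB, dotD, dotZ) !dot_w; kron; fld.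
Qed.

End PhiKernel.
Arguments phi_free {F} r {n}.
(** * Generation by the vectors w_k^(p) *)

Section Generation.
Variables (F : fieldType) (r : F) (n : nat).
Hypotheses (r_neq0 : r != 0) (r2_neq1 : r ^+ 2 != 1).
Implicit Types (x y : LK F n).

Local Notation w := (w F n).
Local Notation nu := (nu r r n).
Local Notation phi := (phi r).

Local Ltac fld := (ring || field); rewrite ?oner_neq0 ?r_neq0 //.

(* The vector w_k^(p), inside V^(n). *)
Definition wvec_at (p k : nat) : LK F n :=
  w k p - r^-1 *: w k.+1 p +
  r ^+ (p - 4) *:
    (if k == 1%N then w 2 3 - r *: w 1 3 else w 1 k.+1 - r *: w 1 k).

Lemma wvecE k : wvec r n k = wvec_at n k.
Proof. by []. Qed.

Lemma nu_far i s t : (0 < i < n)%N -> (0 < s < t)%N -> (t <= n)%N ->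
  s != i -> s != i.+1 -> t != i -> t != i.+1 -> nu i (w s t) = r *: w s t.
Proof. by move=> lt_in st le_tn; case: (nuP r_neq0 lt_in st) => //; lia. Qed.

Lemma nu_right i s : (i < n)%N -> (0 < s < i)%N -> nu i (w s i) = w s i.+1.
Proof.
move=> lt_in st; case: (nuP r_neq0 _ st) => // *; try lia.
Qed.

Lemma nu_left i t : (0 < i)%N -> (i.+1 < t)%N -> (t <= n)%N ->
  nu i (w i t) = w i.+1 t.
Proof.
move=> lt_in st le_tn; have it : (0 < i < t)%N by lia.
by case: (nuP r_neq0 _ it) => // *; try lia.
Qed.

Lemma nu_wvec1 p : (4 <= p < n)%N -> nu p (wvec_at p 1) = wvec_at p.+1 1.
Proof.
move=> lt_pn; rewrite /wvec_at /= !(linearB, linearD, linearZ) /=.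
rewrite !nu_right ?nu_far //; try lia.
have -> : (p.+1 - 4)%N = (p - 4).+1 by lia.
apply: lk_eqP => s t st le_tn; rewrite !entryE !entry_w // exprS; ring.
Qed.

Lemma nu_wvec p k : (0 < k)%N -> (k.+2 < p)%N -> (p <= n)%N ->
  nu k.+1 (wvec_at p k) = r *: wvec_at p k + wvec_at p k.+1.
Proof.
move=> k_gt0 lt_kp le_pn; rewrite /wvec_at.
case: eqP => [->|k1] /=.
  rewrite !(linearN, linearB, linearD, linearZ) /= nu_left ?[nu _ (w 1 p)]nu_far; try lia.
  rewrite ![nu 2 _]nu_wE /nu_w /=; try lia.
  apply: lk_eqP => s t st le_tn; rewrite !entryE !entry_w //; field.
  by rewrite r_neq0.
rewrite (_ : (k.+1 == 1%N) = false); last lia.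
rewrite !(linearN, linearB, linearD, linearZ) /=.
rewrite nu_left ?[nu _ (w 1 k.+1)]nu_right ?nu_far //; try lia.
apply: lk_eqP => s t st le_tn; rewrite !entryE !entry_w //; by fld.
Qed.

(** Starting from w_1^(4), g_p raises p while k = 1, and then g_(k+1) - r raises k. *)
Lemma wvec_at_ind (P : LK F n -> Prop) : (4 <= n)%N ->
    (forall a x y, P x -> P y -> P (a *: x + y)) ->
    (forall i x, (0 < i < n)%N -> P x -> P (nu i x)) ->
    P (wvec_at 4 1) ->
  forall p k, (4 <= p <= n)%N -> (0 < k)%N -> (k.+1 < p)%N -> P (wvec_at p k).
Proof.
move=> n_ge4 PD Pnu P41 p k; elim: p k => [|p IHp] k lt_pn; first by lia.
elim: k => [|[|k] IHk] k_gt0 lt_kp; first by lia.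
  (* The superscript is p+1, so p = 3 is the starting vector w_1^(4). *)
  have [p3|p3] := eqVneq p 3; first by rewrite p3.
  by rewrite -nu_wvec1; [apply: Pnu; [lia | apply: IHp; lia] | lia].
have le_pn : (p.+1 <= n)%N by lia.
have e := nu_wvec (isT : (0 < k.+1)%N) lt_kp le_pn.
have -> : wvec_at p.+1 k.+2 = (- r) *: wvec_at p.+1 k.+1 + nu k.+2 (wvec_at p.+1 k.+1).
  by rewrite e scaleNr addKr.
have Pk : P (wvec_at p.+1 k.+1) by apply: IHk => //; lia.
by apply: PD; [|apply: Pnu => //; lia].
Qed.

Lemma phi_free_wvec41 : (4 <= n)%N -> wvec_at 4 1 \in phi_free r.
Proof.
move=> n_ge4; apply/phi_freeP => j jP; rewrite /wvec_at /=.
rewrite !(phiB, phiD, phiZ) !phi_w; try lia.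
rewrite /wt /=; kron; fld.
Qed.

Lemma phi_free_wvec_at p k : (4 <= p <= n)%N -> (0 < k)%N -> (k.+1 < p)%N ->
  wvec_at p k \in phi_free r.
Proof.
move=> lt_pn k0 kp; have n_ge4 : (4 <= n)%N by lia.
apply: (wvec_at_ind (P := fun x => x \in phi_free r) n_ge4 _ _
  (phi_free_wvec41 n_ge4) lt_pn k0 kp).
- exact: phi_free_lin.
by move=> i x lt_in xP; exact: phi_free_nu.
Qed.

(** The rank-one corrections vanish since phi_4 x = 0 and phi_2 y = 0. Entries surviving g_3 - r
    have exactly one index in {3,4}, those surviving g_1 - r exactly one in {1,2}: only the four
    coordinates of w_1^(4) remain. *)
Lemma nu_rank1 x : (4 <= n)%N -> x \in phi_free r ->
  let y := nu 3 x - r *: x in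
  nu 1 y - r *: y = dot (wvec_at 4 1) x *: wvec_at 4 1.
Proof.
move=> n_ge4 xP y.
have yP : y \in phi_free r.
  rewrite /y addrC -scaleNr; apply: phi_free_lin => //.
  by apply: phi_free_nu => //; lia.
have x4 : phi 4 x = 0 by move/phi_freeP: xP => -> //; lia.
have y2 : phi 2 y = 0 by move/phi_freeP: yP => -> //; lia.
have -> : dot (wvec_at 4 1) x =
    entry 1 4 x - r^-1 * entry 2 4 x + (entry 2 3 x - r * entry 1 3 x).
  by rewrite dotC /wvec_at /= expr0 scale1r !(dotB, dotD, dotZ) !dot_w.
apply: lk_eqP => s t st le_tn.
rewrite !entryE entry_nu // ?y2 //; last by lia.
rewrite mulr0 mul0r addr0 expr0 mul1r !entry_w //.
rewrite /y.
rewrite /perm_entry; kron; rewrite ?entryE ?entry_nu ?x4; try lia.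
all: rewrite /perm_entry; kron.
all: try by fld.
Qed.
End Generation.
Lemma sum_kron (F : fieldType) N s (f : nat -> F) :
  \sum_(k < N) f k * (k == s :> nat)%:R = if (s < N)%N then f s else 0.
Proof.
case: ltnP => [lt_sN|le_Ns].
  rewrite (bigD1 (Ordinal lt_sN)) //= eqxx mulr1 big1 ?addr0 // => k.
  by rewrite -val_eqE /= => /negbTE->; rewrite mulr0.
by rewrite big1 // => k _; have := ltn_ord k; case: eqP => [->|]; [lia | rewrite mulr0].
Qed.

(** * Passing between V^(p) and V^(n) *)

Section Restriction.
Variables (F : fieldType).

Lemma lk_incl_w p n s t : (0 < s < t)%N -> (t <= p)%N ->
  LK_incl F p n (w F p s t) = w F n s t.
Proof. by move=> st le_tp; rewrite lfunE /= lin_ext_w. Qed.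

Lemma entry_lk_incl p n (x : LK F p) s t : (0 < s < t)%N -> (t <= n)%N ->
  entry s t (LK_incl F p n x) = entry s t x.
Proof.
move=> st le_tn; elim/lk_ind: x => [|a x y xE yE|a b ab le_bp].
- by rewrite linear0 !entry0.
- by rewrite linearP /= !entryP xE yE.
rewrite lk_incl_w // entry_w //; have [le_tp|lt_pt] := leqP t p.
  by rewrite entry_w.
rewrite entry_out ?negb_and ?[(t <= p)%N]leqNgt ?lt_pt ?orbT //.
by case: eqP => //= as_; case: eqP => //= bt; lia.
Qed.

Lemma phi_lk_incl r p n j (x : LK F p) : (p <= n)%N ->
  phi r j (LK_incl F p n x) = phi r j x.
Proof.
move=> le_pn; elim/lk_ind: x => [|a x y xE yE|a b ab le_bp].
- by rewrite linear0 !phi0.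
- by rewrite linearP /= !phiP xE yE.
by rewrite lk_incl_w // !phi_w //; apply: leq_trans le_pn.
Qed.

(** From n+1 to n, [LK_incl] is truncation: it sends w_{s,n+1} to the default value 0 of [w]. *)
Lemma lk_incl_restr n (x : LK F n.+1) :
    (forall s, (0 < s < n.+1)%N -> entry s n.+1 x = 0) ->
  LK_incl F n n.+1 (LK_incl F n.+1 n x) = x.
Proof.
move=> x0; apply: lk_eqP => s t st le_tn; rewrite entry_lk_incl //.
have [le_t|lt_t] := leqP t n; first by rewrite entry_lk_incl.
have -> : t = n.+1 by lia.
by rewrite x0 ?entry_out //; lia.
Qed.

End Restriction.

(** * The coordinates along w_{1,n}, .., w_{n-1,n} *)

Section TopColumn.
Variables (F : fieldType) (r : F) (n : nat).
Hypotheses (r_neq0 : r != 0) (r2_neq1 : r ^+ 2 != 1).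
Implicit Types (x y : LK F n).

Local Notation w := (w F n).
Local Notation phi := (phi r).

Lemma entry_top_wvec k s : (4 <= n)%N -> (0 < k)%N -> (k.+1 < n)%N -> (0 < s < n)%N ->
  entry s n (wvec_at r n n k) = (k == s)%:R - r^-1 * (k.+1 == s)%:R.
Proof.
move=> n_ge4 k_gt0 lt_kn sn; rewrite /wvec_at; case: (k == 1)%N;
  rewrite !entryE !entry_w // eqxx !andbT; kron; ring.
Qed.

(** The top columns of the w_k^(n) form a bidiagonal matrix; the conventions c_0 = c_(n-1) = 0 make
    the formula uniform in s. *)
Lemma entry_top_comb (c : nat -> F) s : (4 <= n)%N ->
    c 0 = 0 -> c n.-1 = 0 -> (0 < s < n)%N ->
  entry s n (\sum_(k < n - 2) c k.+1 *: wvec_at r n n k.+1) = c s - r^-1 * c s.-1.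
Proof.
move=> n_ge4 c0 cn sn; rewrite entry_sum.
(* The factor [1 < s] guards the truncated [s.-2], which would give a spurious term at s = 1. *)
rewrite (eq_bigr (fun k : 'I_(n - 2) => c k.+1 * (k == s.-1 :> nat)%:R
   - r^-1 * (c k.+1 * (k == s.-2 :> nat)%:R * (1 < s)%:R))); last first.
  move=> k _; have lt_k := ltn_ord k; rewrite entryZ entry_top_wvec //; try lia.
  rewrite (_ : (k.+1 == s) = (k == s.-1 :> nat)); last lia.
  case: (ltnP 1 s) => s1; last by rewrite (_ : (k.+2 == s) = false) /=; [ring | lia].
  by rewrite (_ : (k.+2 == s) = (k == s.-2 :> nat)) /=; [ring | lia].
rewrite sumrB -mulr_sumr -mulr_suml (sum_kron _ _ (fun k => c k.+1)).
rewrite (sum_kron _ _ (fun k => c k.+1)) [s.-1.+1]prednK; last lia.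
case: (ltnP 1 s) => s1; last first.
  have -> : s = 1%N by lia.
  by rewrite c0 mulr0 !mulr0 /= ifT //; lia.
rewrite mulr1; have -> : s.-2.+1 = s.-1 by lia.
rewrite [in X in _ - _ * X]ifT; last lia.
case: ltnP => // le_s; have -> : s = n.-1 by lia.
by rewrite cn.
Qed.

(** The solution of c_s - r^-1 c_(s-1) = x_{s,n} with c_0 = 0. *)
Fixpoint column_sum x (k : nat) : F :=
  if k is k'.+1 then entry k n x + r^-1 * column_sum x k' else 0.

(** Unrolled, the last value is the sum of the r^-(n-1-s) x_{s,n}. So phi_n x = 0 is exactly the
    boundary condition c_(n-1) = 0 of [entry_top_comb]. *)
Lemma column_sum_last x : column_sum x n.-1 = phi n x.
Proof.
have colE a b k : (0 < a < b)%N -> (b <= n)%N -> (k < n)%N ->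
    column_sum (w a b) k = if (a <= k)%N && (b == n) then (r ^+ (k - a))^-1 else 0.
  move=> ab le_bn; elim: k => [|k IHk] lt_kn /=; first by rewrite ifF //; lia.
  rewrite entry_w ?leqnn //.
  rewrite IHk; last by lia.
  have [_|_] := eqVneq b n; last by rewrite !andbF mulr0 addr0.
  rewrite !andbT; have [lt_ka|lt_ak|->] := ltngtP a k.+1.
  - have le_ak : (a <= k)%N by lia.
    by rewrite le_ak add0r -invfM -exprS; congr (_ ^+ _)^-1; lia.
  - by rewrite ifF ?mulr0 ?addr0 //; lia.
  by rewrite ltnn subnn expr0 invr1 mulr0 addr0.
elim/lk_ind: x => [|a x y xE yE|a b ab le_bn].
- rewrite phi0; elim: n.-1 => //= k ->; rewrite entry0; ring.
- rewrite phiP -xE -yE; elim: n.-1 => /= [|k ->]; rewrite ?entryP; ring.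
rewrite phi_w // colE //; last lia.
rewrite (_ : (n == a) = false) ?mul0r ?add0r; last lia.
rewrite [n == b]eq_sym; case: eqP => [->|_]; last by rewrite andbF mul0r.
rewrite andbT ifT; last lia.
by rewrite mul1r /wt; congr (_ ^+ _)^-1; lia.
Qed.

End TopColumn.

(** * The w_k^(p) span the common kernel *)

Section Spanning.
Variables (F : fieldType) (r : F).
Hypotheses (r_neq0 : r != 0) (r2_neq1 : r ^+ 2 != 1) (q1_neq0 : 1 + r ^+ 2 != 0).

Local Ltac fld := (ring || field); rewrite ?expf_neq0 ?oner_neq0 ?r_neq0 //.

(** Subtracting the combination with coefficients [column_sum] clears the coordinates w_{s,n+1};
    what is left lies in V^(n) and in the common kernel. *)
Lemma phi_free_top n (x : LK F n.+1) : (3 <= n)%N -> x \in phi_free r ->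
  exists2 z : LK F n, z \in phi_free r &
    x = LK_incl F n n.+1 z +
        \sum_(k < n.+1 - 2) column_sum r x k.+1 *: wvec_at r n.+1 n.+1 k.+1.
Proof.
move=> n_ge3 xP; set S := \sum_(_ < _) _.
have SP : S \in phi_free r.
  rewrite /S; elim/big_rec: _ => [|k y _ yP]; first exact: phi_free0.
  apply: phi_free_lin yP; have lt_k := ltn_ord k.
  by apply: phi_free_wvec_at => //; lia.
pose y := x - S.
have yP : y \in phi_free r.
  by rewrite /y addrC -scaleN1r; apply: phi_free_lin.
have y0 s : (0 < s < n.+1)%N -> entry s n.+1 y = 0.
  move=> sn; rewrite /y entryB /S entry_top_comb //.
    by case: s sn => // s _ /=; ring.
  by rewrite (column_sum_last r_neq0 r2_neq1); move/phi_freeP: xP => -> //; lia.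
have yE := lk_incl_restr y0.
exists (LK_incl F n.+1 n y); last by rewrite yE /y subrK.
apply/phi_freeP => j jP; rewrite -(phi_lk_incl r j _ (leqnSn n)) yE.
by move/phi_freeP: yP => -> //; lia.
Qed.

(** Three equations in three coordinates, with determinant 1 + r^2 up to a unit. *)
Lemma phi_free3 (x : LK F 3) : x \in phi_free r -> x = 0.
Proof.
move/phi_freeP => xP.
have xE : x = entry 1 2 x *: w F 3 1 2 + entry 1 3 x *: w F 3 1 3
    + entry 2 3 x *: w F 3 2 3.
  apply: lk_eqP => s t st le_t3; rewrite !entryE !entry_w //.
  by kron; rewrite ?mulr1 ?mulr0 ?addr0 ?add0r //; exfalso; lia.
set a := entry 1 2 x in xE *; set b := entry 1 3 x in xE *.
set c := entry 2 3 x in xE *.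
have phiE j : phi r j x = a * phi r j (w F 3 1 2) + b * phi r j (w F 3 1 3)
    + c * phi r j (w F 3 2 3) by rewrite xE !(phiD, phiZ).
have e1 : a + r * b = 0.
  by rewrite -(xP 1%N isT) phiE !phi_w // /wt /=; fld.
have e2 : a + c = 0 by rewrite -(xP 2%N isT) phiE !phi_w // /wt /=; fld.
have e3 : b + r * c = 0.
  rewrite -[RHS](mulr0 r) -(xP 3%N isT) phiE !phi_w // /wt /=; fld.
have b0 : b = 0.
  have : (1 + r ^+ 2) * b = (b + r * c) - r * (a + c) + r * (a + r * b) by ring.
  rewrite e1 e2 e3 !mulr0 subrr addr0 => /eqP.
  by rewrite mulf_eq0 (negbTE q1_neq0) => /eqP.
have a0 : a = 0 by move: e1; rewrite b0 mulr0 addr0.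
have c0 : c = 0 by move: e2; rewrite a0 add0r.
by rewrite xE a0 b0 c0 !scale0r !addr0.
Qed.

(** Top columns are peeled off one at a time until K(3) = 0 is reached. *)
Lemma phi_free_span n (P : LK F n -> Prop) : (3 <= n)%N -> P 0 ->
    (forall a x y, P x -> P y -> P (a *: x + y)) ->
    (forall p k, (4 <= p <= n)%N -> (0 < k)%N -> (k.+1 < p)%N -> P (wvec_at r n p k)) ->
  forall x, x \in phi_free r -> P x.
Proof.
elim: n P => [//|n IHn] P n_ge3 P0 PD Pw x xP.
have [n2|n3] := ltnP n 3.
  have n2' : n = 2 by lia.
  by subst n; rewrite (phi_free3 xP).
have [z zP ->] := phi_free_top n3 xP.
have PDD u v : P u -> P v -> P (u + v) by rewrite -{2}[u]scale1r; apply: PD.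
apply: (PDD); last first.
  elim/big_rec: _ => // k y _ Py; apply: PD => //; have lt_k := ltn_ord k.
  by apply: Pw; lia.
(* The predicate is pulled back along the inclusion, which fixes the w_k^(p). *)
apply: (IHn (fun z => P (LK_incl F n n.+1 z))) zP => //.
- by rewrite linear0.
- by move=> a u v Pu Pv; rewrite linearP; apply: PD.
move=> p k pn k0 kp; suff -> : LK_incl F n n.+1 (wvec_at r n p k) = wvec_at r n.+1 p k.
  by apply: Pw => //; lia.
rewrite /wvec_at; case: ifP => k1; rewrite !(linearB, linearD, linearZ) /=;
  rewrite !lk_incl_w ?scalerDr //; lia.
Qed.

End Spanning.
(** * Nondegeneracy and uniqueness *)

Section Gram.
Variables (F : fieldType) (r : F) (n : nat).
Hypotheses (r_neq0 : r != 0) (r2_neq1 : r ^+ 2 != 1).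
Implicit Types (x y : LK F n).

Local Notation w := (w F n).
Local Notation phi := (phi r).
Local Notation q := (r ^+ 2).

Lemma qintE k : (q - 1) * qint q k = q ^+ k - 1.
Proof. by symmetry; apply: subrX1. Qed.

Lemma phi_at0 x : phi 0 x = 0.
Proof.
elim/lk_ind: x => [|a x y xE yE|s t st le_tn]; first exact: phi0.
  by rewrite phiP xE yE mulr0 addr0.
rewrite phi_w // (_ : (0%N == s) = false); last lia.
by rewrite (_ : (0%N == t) = false) ?mul0r ?addr0; last lia.
Qed.

Lemma phi_sum i x : (0 < i <= n)%N ->
  phi i x = \sum_(t < n.+1) (i < t)%:R * (wt r i t * entry i t x)
          + \sum_(s < n.+1) (0 < s < i)%:R * (entry s i x / wt r s i).
Proof.
move=> lt_in; elim/lk_ind: x => [|a x y xE yE|a b ab le_bn].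
- by rewrite phi0 !big1 ?addr0 // => j _; rewrite entry0 ?mul0r !mulr0.
- rewrite phiP xE yE mulrDr !mulr_sumr addrACA; congr (_ + _); rewrite -big_split;
    by apply: eq_bigr => j _; rewrite /= entryP; ring.
rewrite phi_w //; congr (_ + _).
  rewrite (eq_bigr (fun t : 'I_n.+1 => (i == a)%:R * wt r i t * (t == b :> nat)%:R)).
    rewrite (sum_kron _ _ (fun t => (i == a)%:R * wt r i t)) ltnS le_bn /=.
    by case: eqP => [->|_] /=; ring.
  move=> t _; have le_tn : (t <= n)%N by rewrite -ltnS.
  have [lt_it|le_ti] := ltnP i t; first by rewrite entry_w //; [kron; ring | lia].
  by kron; try ring; lia.
rewrite (eq_bigr (fun s : 'I_n.+1 => (i == b)%:R / wt r s i * (s == a :> nat)%:R)).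
  rewrite (sum_kron _ _ (fun s => (i == b)%:R / wt r s i)) ifT; last lia.
  by case: eqP => [->|_] /=; ring.
move=> s _; have [si|si] := boolP (0 < s < i)%N.
  by rewrite entry_w //; [kron; ring | lia].
by kron; try ring; lia.
Qed.

(** The vector that represents the functional sum of the a_j phi_j under [dot]. *)
Definition phi_comb (a : nat -> F) : LK F n :=
  [ffun p : lkpair n => a (val p).1 * wt r (val p).1 (val p).2
                        + a (val p).2 / wt r (val p).1 (val p).2].

Lemma entry_phi_comb a s t : (0 < s < t)%N -> (t <= n)%N ->
  entry s t (phi_comb a) = a s * wt r s t + a t / wt r s t.
Proof.
move=> st le_tn; have [p [<- <-]] := lkpair_ex st le_tn.
by rewrite entry_pair ffunE.
Qed.

Lemma dot_phi_comb a x : dot x (phi_comb a) = \sum_(j < n.+1) a j * phi j x.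
Proof.
elim/lk_ind: x => [|b x y xE yE|s t st le_tn].
- by rewrite dotC dot0 big1 // => j _; rewrite phi0 mulr0.
- rewrite dotC dotP ![dot (phi_comb a) _]dotC xE yE mulr_sumr -big_split.
  by apply: eq_bigr => j _; rewrite /= phiP; ring.
rewrite dotC dot_w entry_phi_comb //.
rewrite (eq_bigr (fun j : 'I_n.+1 => a j * wt r s t * (j == s :> nat)%:R
    + a j / wt r s t * (j == t :> nat)%:R)).
  rewrite big_split (sum_kron _ _ (fun j => a j * wt r s t)).
  rewrite (sum_kron _ _ (fun j => a j / wt r s t)).
  by rewrite !ifT //; lia.
by move=> j _; rewrite phi_w //; ring.
Qed.

Lemma sum_wt_right i N : (i <= N)%N ->
  \sum_(t < N.+1) (i < t)%:R * wt r i t ^+ 2 = qint q (N - i).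
Proof.
elim: N => [|N IHN] le_iN; rewrite big_ord_recr /=.
  by rewrite (_ : i = 0%N) ?big_ord0 /qint ?big_ord0 /= ?mul0r ?addr0; last lia.
have [lt_iN|le_Ni] := ltnP i N.+1.
  rewrite IHN // mul1r subSn // /qint [in RHS]big_ord_recr /=; congr (_ + _).
  by rewrite /wt -!exprM mulnC; congr (_ ^+ (_ * _)); lia.
have -> : i = N.+1 by lia.
rewrite subnn /qint big_ord0 big1 ?mul0r ?addr0 // => t _.
by rewrite (_ : (N.+1 < t)%N = false) ?mul0r //; have := ltn_ord t; lia.
Qed.

(** The factor q^(i-1) clears negative powers: the terms become q^s, with s up to N or i - 1,
    whichever is smaller. *)
Lemma sum_wt_left i N : (0 < i)%N ->
  q ^+ i.-1 * (\sum_(s < N.+1) (0 < s < i)%:R * (wt r s i)^-1 ^+ 2)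
  = q * qint q (minn N i.-1).
Proof.
move=> i_gt0; elim: N => [|N IHN]; rewrite big_ord_recr /=.
  by rewrite big_ord0 min0n /qint big_ord0; ring.
rewrite mulrDr IHN; have [lt_Ni|le_iN] := ltnP N.+1 i.
  have [-> ->] : minn N i.-1 = N /\ minn N.+1 i.-1 = N.+1 by lia.
  rewrite /qint [in RHS]big_ord_recr /= mul1r mulrDr; congr (_ + _).
  have -> : q ^+ i.-1 = q * q ^+ N * wt r N.+1 i ^+ 2.
    rewrite /wt -exprS -!exprM -exprD; congr (_ ^+ _); lia.
  by have := wt_neq0 r_neq0 N.+1 i; move: (wt r _ _) => u u0; field; rewrite u0.
have -> : minn N.+1 i.-1 = minn N i.-1 by lia.
by rewrite mul0r mulr0 addr0.
Qed.

(* The Gram matrix of the functionals phi_j has all its off-diagonal entries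
   equal to 1 and its diagonal entries equal to 1 + gram_diag j. *)
Definition gram_diag (i : nat) : F := q * qint q (n - 2) / q ^+ i.-1.

(** For i != j only the basis vector on {i,j} is seen by both phi_i and phi_j, with inverse weights,
    whence the entry 1. The diagonal entry is [n-i] + q^(2-i) [i-1] = 1 + q^(2-i) [n-2]. *)
Lemma phi_phi_comb a i : (2 <= n)%N -> (0 < i <= n)%N ->
  phi i (phi_comb a) = \sum_(j < n) a j.+1 + a i * gram_diag i.
Proof.
move=> n_ge2 lt_in; rewrite phi_sum //.
rewrite (eq_bigr (fun t : 'I_n.+1 => (i < t)%:R * a t
    + a i * ((i < t)%:R * wt r i t ^+ 2))); last first.
  move=> t _; case: ltnP => [lt_it|_]; last by rewrite !mul0r; ring.
  rewrite entry_phi_comb; [|lia|by rewrite -ltnS].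
  by have := wt_neq0 r_neq0 i t; move: (wt r _ _) => u u0; field; rewrite u0.
rewrite [X in _ + X](eq_bigr (fun s : 'I_n.+1 => (0 < s < i)%:R * a s
    + a i * ((0 < s < i)%:R * (wt r s i)^-1 ^+ 2))); last first.
  move=> s _; case: (boolP (0 < s < i)%N) => [lt_it|_]; last by rewrite !mul0r; ring.
  rewrite entry_phi_comb //; last lia.
  by have := wt_neq0 r_neq0 s i; move: (wt r _ _) => u u0; field; rewrite u0.
rewrite !big_split /= -!mulr_sumr sum_wt_right; last lia.
set L := \sum_(_ < _) _ * (_ ^-1 ^+ 2); rewrite addrACA -mulrDr.
have qi_neq0 : q ^+ i.-1 != 0 by rewrite !expf_neq0.
have -> : qint q (n - i) + L = 1 + gram_diag i.
  apply: (mulfI qi_neq0); rewrite mulrDr sum_wt_left; last lia.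
  have -> : minn n i.-1 = i.-1 by lia.
  rewrite /gram_diag mulrDr mulr1 mulrCA divff // mulr1.
  have q1 : q - 1 != 0 by rewrite subr_eq0.
  apply: (mulfI q1).
  rewrite !mulrDr ![(q - 1) * (_ * qint _ _)]mulrCA !qintE.
  rewrite !mulrBr !mulr1 -!exprD -exprS.
  have -> : (i.-1 + (n - i) = (n - 2).+1)%N by lia.
  by rewrite [q ^+ i.-1.+1]exprS [q ^+ (n - 2).+1]exprS; ring.
rewrite mulrDr mulr1 addrA; congr (_ + _).
(* The 1 on the diagonal supplies the term t = i missing between the ranges t < i and t > i. *)
have {1}-> : a i = \sum_(t < n.+1) a t * (t == i :> nat)%:R.
  by rewrite (sum_kron n.+1 i a) ifT //; lia.
rewrite -!big_split big_ord_recl /= (_ : (0%N == i) = false); last lia.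
rewrite mulr0 !mul0r !add0r; apply: eq_bigr => k _; rewrite /bump /= add1n.
by have [lt_jk|lt_kj|ej] := ltngtP i k.+1; rewrite /=; ring.
Qed.

Hypotheses (q1_neq0 : 1 + q != 0) (n_ge3 : (3 <= n)%N).
Hypotheses (qn2_neq0 : qint q (n - 2) != 0) (qn1_neq0 : qint q (n - 1) != 0).

Lemma gram_diag_neq0 i : gram_diag i != 0.
Proof. by rewrite /gram_diag !mulf_neq0 ?invr_neq0 ?expf_neq0. Qed.

(** Write d_i for [gram_diag] and s for the sum of the a_j. Dividing row i by d_i and summing gives
    s T = sum of the b_j / d_j, so T != 0 suffices; and T = (1+q) [n-1] / (q [n-2]) because q [n-2]
    + [n] = (1+q) [n-1]. *)
Lemma gram_solvable (b : nat -> F) : exists a : nat -> F, forall i,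
  \sum_(j < n) a j.+1 + a i * gram_diag i = b i.
Proof.
pose T := 1 + \sum_(j < n) (gram_diag j.+1)^-1.
have T_neq0 : T != 0.
  have -> : T = (1 + q) * qint q (n - 1) / (q * qint q (n - 2)).
    have q0 : q * qint q (n - 2) != 0 by rewrite mulf_neq0 ?expf_neq0.
    apply: (mulIf q0); rewrite divfK // /T mulrDl mul1r mulr_suml.
    rewrite (eq_bigr (fun j : 'I_n => q ^+ j)); last first.
      by move=> j _; rewrite /gram_diag invfM invrK mulrC mulrA divff ?mul1r.
    rewrite -/(qint q n); apply: (mulfI (x := q - 1)); first by rewrite subr_eq0.
    rewrite mulrDr mulrCA [in RHS]mulrCA !qintE.
    have -> : (n - 1 = (n - 2).+1)%N by lia.
    have {2}-> : n = (n - 2).+2 by lia.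
    by rewrite !exprS; ring.
  by rewrite !mulf_neq0 ?invr_neq0 ?mulf_neq0 ?expf_neq0.
pose s := (\sum_(j < n) b j.+1 / gram_diag j.+1) / T.
exists (fun i => (b i - s) / gram_diag i) => i.
rewrite divfK ?gram_diag_neq0 //.
rewrite (eq_bigr (fun j : 'I_n => b j.+1 / gram_diag j.+1
    - s * (gram_diag j.+1)^-1)); last first.
  by move=> j _; rewrite mulrBl.
rewrite sumrB -mulr_sumr.
have -> : \sum_(j < n) b j.+1 / gram_diag j.+1 = s * T by rewrite divfK.
by rewrite /T; ring.
Qed.

(** Subtracting a suitable [phi_comb] brings w_{s,t} into the common kernel, and x is orthogonal to
    every [phi_comb]; so each coordinate of x is 0. *)
Lemma phi_free_nondeg x : x \in phi_free r ->
  (forall y, y \in phi_free r -> dot x y = 0) -> x = 0.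
Proof.
move=> xP x_orth; apply: lk_eqP => s t st le_tn; rewrite entry0 -dot_w.
have [a aP] := gram_solvable (fun i => phi i (w s t)).
have zP : w s t - phi_comb a \in phi_free r.
  apply/phi_freeP => i lt_in; rewrite phiB phi_phi_comb //; last lia.
  by rewrite aP subrr.
have := x_orth _ zP; rewrite dotB dot_phi_comb big1 ?subr0 // => j _.
move/phi_freeP: xP => xP; have [-> | j0] := eqVneq (j : nat) 0%N.
  by rewrite phi_at0 mulr0.
by rewrite xP ?mulr0 // lt0n j0 -ltnS ltn_ord.
Qed.

End Gram.

(** * Invariant subspaces: K(n) is the only proper one *)

Section UniqueInvariant.
Variables (F : fieldType) (r : F) (n : nat).
Hypotheses (r_neq0 : r != 0) (r2_neq1 : r ^+ 2 != 1).
Implicit Types (x y : LK F n) (W : {vspace LK F n}).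

Let m : F := r^-1 - r.
Local Notation w := (w F n).
Local Notation nu := (nu r r n).
Local Notation phi := (phi r).
Local Notation q := (r ^+ 2).
Local Notation K := (K r r n).

Lemma nu_invariant_mem W i x :
  nu_invariant r r W -> (0 < i < n)%N -> x \in W -> nu i x \in W.
Proof.
move=> Winv lt_in xW; apply: (subvP (Winv i _)); first lia.
exact: memv_img.
Qed.

Lemma nu_e_mem W i x :
  nu_invariant r r W -> (0 < i < n)%N -> x \in W -> nu_e r r n i x \in W.
Proof.
move=> Winv lt_in xW; have nuW := nu_invariant_mem Winv lt_in.
rewrite /nu_e scale_lfunE !add_lfunE opp_lfunE scale_lfunE comp_lfunE id_lfunE.
by rewrite memvZ // memvB // memvD ?memvZ ?nuW.
Qed.

Section FromSimpleRoot.
Variable W : {vspace LK F n}.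
Hypothesis Winv : nu_invariant r r W.

(** By way of w_{i,i+2}: g_(i+1) moves the right end, then g_i the left one. *)
Lemma simple_root_up i : (0 < i)%N -> (i.+1 < n)%N ->
  w i i.+1 \in W -> w i.+1 i.+2 \in W.
Proof.
move=> i_gt0 lt_in wW; rewrite -(nu_left r_neq0 r2_neq1) //.
rewrite -(nu_right r_neq0 r2_neq1) //; last lia.
by apply: nu_invariant_mem; [|lia|apply: nu_invariant_mem; [|lia|]].
Qed.

Lemma simple_root_down i : (0 < i)%N -> (i.+1 < n)%N ->
  w i.+1 i.+2 \in W -> w i i.+1 \in W.
Proof.
move=> i_gt0 lt_in wW.
(* Here y = w_{i,i+2} + m w_{i,i+1}; under g_(i+1) the terms in w_{i,i+2} cancel, leaving w_{i,i+1}
   plus a multiple of w_{i+1,i+2}. *)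
pose y := nu i (w i.+1 i.+2) + m *: w i.+1 i.+2.
have yW : y \in W by rewrite memvD ?memvZ // nu_invariant_mem //; lia.
have yE : y = w i i.+2 + m *: w i i.+1.
  rewrite /y; have st : (0 < i.+1 < i.+2)%N by lia.
  have lt_in' : (0 < i < n)%N by lia.
  case: (nuP r_neq0 lt_in' st) => //; try lia; move=> _ _.
  by rewrite wt1 mulr1 -/m subrK.
have -> : w i i.+1 = nu i.+1 y - (m / r) *: w i.+1 i.+2.
  rewrite yE linearD linearZ /= (nu_right r_neq0 r2_neq1); try lia.
  have st : (0 < i < i.+2)%N by lia.
  have lt_in' : (0 < i.+1 < n)%N by lia.
  case: (nuP r_neq0 lt_in' st) => //; try lia; move=> _ _.
  by rewrite wt1 mulr1 -/m subrK addrK.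
by rewrite memvB ?memvZ // nu_invariant_mem //; lia.
Qed.

Lemma simple_root_full i : (0 < i < n)%N -> w i i.+1 \in W -> W = fullv.
Proof.
move=> lt_in wW.
have w1 : w 1 2 \in W.
  elim: i lt_in wW => // -[//|i] IHi lt_in wW.
  by apply: IHi; [lia | apply: simple_root_down; rewrite //; lia].
have ws s : (0 < s < n)%N -> w s s.+1 \in W.
  elim: s => // -[//|s] IHs lt_sn.
  by apply: simple_root_up; [|lia|apply: IHs; lia].
have wst s t : (0 < s < t)%N -> (t <= n)%N -> w s t \in W.
  elim: t => [|t IHt] st le_tn; first lia.
  have [lt_st|le_ts] := ltnP s t.
    rewrite -(nu_right r_neq0 r2_neq1); try lia.
    by apply: nu_invariant_mem; [|lia|apply: IHt; lia].
  have -> : t = s by lia.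
  by apply: ws; lia.
apply: subv_anti; rewrite subvf /=; apply/subvP.
elim/lk_ind => [|a x y xW yW|s t st le_tn] _.
- exact: mem0v.
- by rewrite memvD ?memvZ ?xW ?yW ?memvf.
exact: wst.
Qed.

End FromSimpleRoot.

Hypotheses (q1_neq0 : 1 + q != 0) (n_ge4 : (4 <= n)%N).
Hypotheses (qn2_neq0 : qint q (n - 2) != 0) (qn1_neq0 : qint q (n - 1) != 0).

Lemma K_phi_free x : (x \in K) = (x \in phi_free r).
Proof. by rewrite memK //; lia. Qed.

(** If W contains no w_{i,i+1}, then e_i y, a multiple of w_{i,i+1} lying in W, is 0 for every y in
    W. Taking y = x and y = g_2 x puts x in K(n). *)
Lemma sub_K_or_full W : nu_invariant r r W -> ~~ (W <= K)%VS -> W = fullv.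
Proof.
move=> Winv /subvPn[x xW]; rewrite K_phi_free => xK.
have [/existsP[i /andP[lt_in wW]]|noW] :=
  boolP [exists i : 'I_n, (0 < i)%N && (w i i.+1 \in W)].
  by apply: simple_root_full wW => //; rewrite lt_in ltn_ord.
have e0 y i : y \in W -> (0 < i < n)%N -> phi i y + phi i.+1 y = 0.
  move=> yW lt_in; have := nu_e_mem Winv lt_in yW; rewrite nu_eE //.
  rewrite rpredZeq => /orP[/eqP //|wW]; case/existsP: noW.
  have lt_in' : (i < n)%N by lia.
  by exists (Ordinal lt_in'); rewrite /= wW andbT; case/andP: lt_in.
case/negP: xK; apply: phi_free_of_e => //; first lia.
  by move=> i; apply: e0.
apply: e0; last lia.
by apply: nu_invariant_mem => //; lia.
Qed.

Lemma phi_free_sub W : nu_invariant r r W -> wvec_at r n 4 1 \in W -> (K <= W)%VS.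
Proof.
move=> Winv vW; apply/subvP => x; rewrite K_phi_free.
have wW p k : (4 <= p <= n)%N -> (0 < k)%N -> (k.+1 < p)%N -> wvec_at r n p k \in W.
  apply: (wvec_at_ind r_neq0 r2_neq1 (P := fun x => x \in W)) => //.
    by move=> a u v uW vW'; rewrite memvD ?memvZ.
  by move=> i u lt_in uW; apply: nu_invariant_mem.
move: x; apply: (phi_free_span r_neq0 r2_neq1 q1_neq0 (P := fun x => x \in W)) => //.
- exact: ltnW.
- exact: mem0v.
by move=> a u v uW vW'; rewrite memvD ?memvZ.
Qed.

Lemma sub_K W : nu_invariant r r W -> W != 0%VS -> (W <= K)%VS -> W = K.
Proof.
move=> Winv W0 WK; apply: subv_anti; rewrite WK /=.
have WP x : x \in W -> x \in phi_free r by move=> xW; rewrite -K_phi_free (subvP WK).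
have [[x xW vx]|no] := pselect (exists2 x, x \in W & dot (wvec_at r n 4 1) x != 0).
  (* By [nu_rank1], (g_1 - r)(g_3 - r) x is an element of W and a nonzero multiple of w_1^(4). *)
  apply: phi_free_sub => //; have := rpredZeq W _ (wvec_at r n 4 1).
  move/(_ (dot (wvec_at r n 4 1) x)); rewrite (negbTE vx) /= => <-.
  have yW : nu 3 x - r *: x \in W by rewrite memvB ?memvZ // nu_invariant_mem //; lia.
  rewrite -(nu_rank1 r_neq0 r2_neq1 n_ge4 (WP x xW)).
  by rewrite memvB ?memvZ // nu_invariant_mem //; lia.
case/negP: W0; rewrite -subv0; apply/subvP => x xW; rewrite memv0; apply/eqP.
apply: (phi_free_nondeg r_neq0 r2_neq1 q1_neq0 _ qn2_neq0 qn1_neq0 (WP x xW)); first lia.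
(* Now W is orthogonal to w_1^(4). The generators are symmetric on K(n) and preserve W, so this
   spreads to all w_k^(p), hence to K(n). *)
have dotP41 y : y \in W -> dot (wvec_at r n 4 1) y = 0.
  by move=> yW; apply/eqP/negPn/negP => vy; apply: no; exists y.
have dotV p k : (4 <= p <= n)%N -> (0 < k)%N -> (k.+1 < p)%N ->
    (wvec_at r n p k \in phi_free r) /\
    (forall y, y \in W -> dot (wvec_at r n p k) y = 0).
  apply: (wvec_at_ind r_neq0 r2_neq1
    (P := fun z => z \in phi_free r /\ forall y, y \in W -> dot z y = 0)) => //.
  - move=> a u v [uP u0] [vP v0]; split; first exact: phi_free_lin.
    by move=> y yW; rewrite dotC dotP ![dot y _]dotC u0 // v0 // mulr0 addr0.
  - move=> i u lt_in [uP u0]; split; first exact: phi_free_nu.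
    move=> y yW; have := dot_nu r_neq0 r2_neq1 u y lt_in.
    move/phi_freeP: uP => ->; last lia.
    have /phi_freeP-> := WP y yW; last lia.
    by rewrite !mulr0 !mul0r !subr0 => ->; rewrite u0 // nu_invariant_mem.
  by split; first exact: phi_free_wvec41.
apply: (phi_free_span r_neq0 r2_neq1 q1_neq0 (P := fun y => dot x y = 0)).
- exact: ltnW.
- exact: dot0.
- by move=> a u v u0 v0; rewrite dotP u0 v0 mulr0 addr0.
by move=> p k pn k0 kp; rewrite dotC; apply: (dotV p k pn k0 kp).2.
Qed.

Lemma K_unique : unique_proper_invariant r r K.
Proof.
have v41 : wvec_at r n 4 1 \in K by rewrite K_phi_free phi_free_wvec41.
split; last first.
  move=> W [Winv W0 W1]; have [WK|WK] := boolP (W <= K)%VS; first exact: sub_K.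
  by rewrite (sub_K_or_full Winv WK) eqxx in W1.
split.
- move=> i lt_i; apply/subvP => _ /memv_imgP[x xK ->].
  by rewrite K_phi_free phi_free_nu -?K_phi_free //; lia.
- apply: contraTneq v41 => ->; rewrite memv0; apply/eqP => v0.
  have : entry 1 4 (wvec_at r n 4 1) = 1.
    rewrite /wvec_at /= !entryE !entry_w //=; ring.
  by rewrite v0 entry0 => /eqP; rewrite eq_sym oner_eq0.
(* K(n) is not the whole space: phi_1 takes the value 1 at w_{12}. *)
apply: contraTneq (memvf (w 1 2)) => <-; rewrite K_phi_free.
apply/phi_freeP => phi12; have lt_1n : (0 < 1 <= n)%N by lia.
have := phi12 1%N lt_1n; rewrite phi_w //; last lia.
by rewrite wt1 mul0r addr0 mul1r => /eqP; rewrite oner_eq0.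
Qed.

End UniqueInvariant.

(** * The direct sum decomposition of K(n+1) *)

Section Decomposition.
Variables (F : fieldType) (r : F) (n : nat).
Hypotheses (r_neq0 : r != 0) (r2_neq1 : r ^+ 2 != 1) (q1_neq0 : 1 + r ^+ 2 != 0).
Hypothesis n_ge3 : (3 <= n)%N.

Local Notation wv k := (wvec_at r n.+1 n.+1 k).

Lemma wvec_tuple : [seq wvec r n.+1 k | k <- iota 1 (n.+1 - 2)]
  = [tuple wv i.+1 | i < n.+1 - 2].
Proof.
apply: (@eq_from_nth _ 0) => [|i]; first by rewrite size_map size_iota size_tuple.
rewrite size_map size_iota => lt_i.
by rewrite (nth_map 0%N) ?size_iota // nth_iota // (nth_mktuple _ _ (Ordinal lt_i)).
Qed.

(** A zero top column gives c_s = r^-1 c_(s-1) with c_0 = 0. This yields both the independence of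
    the w_k^(n+1) and the zero intersection with V^(n). *)
Lemma wvec_comb_eq0 (c : 'I_(n.+1 - 2) -> F) :
    (forall s, (0 < s < n.+1)%N -> entry s n.+1 (\sum_i c i *: wv i.+1) = 0) ->
  forall i, c i = 0.
Proof.
(* Extends c to all naturals, shifted by one and 0 off its range, to meet the boundary conditions of
   [entry_top_comb]. *)
move=> top0; pose d k := if k is k'.+1 then oapp c 0 (insub k') else 0.
have dE (i : 'I_(n.+1 - 2)) : d i.+1 = c i by rewrite /d valK.
have d_last : d n.+1.-1 = 0.
  by case: n n_ge3 c top0 @d dE => // k _ c _ d _; rewrite /d /= insubF //; lia.
have sE : \sum_i c i *: wv i.+1 = \sum_(i < n.+1 - 2) d i.+1 *: wv i.+1.
  by apply: eq_bigr => i _; rewrite dE.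
have d0 s : (s < n.+1)%N -> d s = 0.
  elim: s => // s IHs lt_sn; have := top0 s.+1 lt_sn.
  rewrite sE entry_top_comb // => /eqP; rewrite subr_eq0 => /eqP->.
  by rewrite IHs ?mulr0 // ltnW.
by move=> i; rewrite -dE d0 //; have := ltn_ord i; lia.
Qed.

Lemma free_wvec : free [seq wvec r n.+1 k | k <- iota 1 (n.+1 - 2)].
Proof.
rewrite wvec_tuple; apply/freeP => c c0; apply: wvec_comb_eq0 => s _.
have -> : \sum_i c i *: wv i.+1 = 0; last exact: entry0.
by rewrite -[RHS]c0; apply: eq_bigr => i _; rewrite nth_mktuple.
Qed.

Lemma dim_wspan : \dim (wspan r n.+1) = (n.+1 - 2)%N.
Proof. by have /eqP-> := free_wvec; rewrite size_map size_iota. Qed.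

Lemma lk_incl_wspan : (LK_incl F n n.+1 @: K r r n :&: wspan r n.+1 = 0)%VS.
Proof.
apply/eqP; rewrite -subv0; apply/subvP => x /memv_capP[/memv_imgP[z _ xz]].
rewrite /wspan wvec_tuple; set X := [tuple _ | _ < _] => /coord_span xE.
rewrite memv0 xE big1 // => i _.
suff -> : coord X i x = 0 by rewrite scale0r.
move: i; apply: wvec_comb_eq0 => s sn.
have -> : \sum_i coord X i x *: wv i.+1 = x.
  by rewrite [RHS]xE; apply: eq_bigr => j _; rewrite nth_mktuple.
by rewrite xz entry_lk_incl // entry_out //; lia.
Qed.

Lemma K_decomp : K r r n.+1 = (LK_incl F n n.+1 @: K r r n + wspan r n.+1)%VS.
Proof.
have KE (x : LK F n) : (x \in K r r n) = (x \in phi_free r) by rewrite memK.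
have KE' (x : LK F n.+1) : (x \in K r r n.+1) = (x \in phi_free r).
  by rewrite memK //; lia.
apply: subv_anti; apply/andP; split.
  apply/subvP => x; rewrite KE' => xP.
  have [z zP ->] := phi_free_top r_neq0 r2_neq1 q1_neq0 n_ge3 xP.
  apply: memv_add; first by apply: memv_img; rewrite KE.
  apply: memv_suml => i _; apply: memvZ; apply: memv_span.
  apply/mapP; exists i.+1; rewrite ?wvecE // mem_iota.
  by have := ltn_ord i; lia.
rewrite subv_add; apply/andP; split; apply/subvP => x.
  case/memv_imgP=> z; rewrite KE KE' => /phi_freeP zP ->.
  apply/phi_freeP => j jP; rewrite phi_lk_incl //.
  have [le_jn|lt_nj] := leqP j n; first by rewrite zP //; lia.
  (* For j = n+1 no basis vector of V^(n) involves the index j. *)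
  elim/lk_ind: z {zP} => [|a u v uE vE|s t st le_tn]; first by rewrite phi0.
    by rewrite phiP uE vE mulr0 addr0.
  rewrite phi_w // (_ : (j == s) = false); last lia.
  by rewrite (_ : (j == t) = false) ?mul0r ?addr0 //; lia.
apply/subvP: x; apply/span_subvP => x /mapP[k]; rewrite mem_iota => kP ->.
by rewrite KE' wvecE phi_free_wvec_at //; lia.
Qed.

End Decomposition.

Lemma K3_eq0 (F : fieldType) (r : F) :
  r != 0 -> r ^+ 2 != 1 -> 1 + r ^+ 2 != 0 -> K r r 3 = 0%VS.
Proof.
move=> r0 r21 q1; apply/eqP; rewrite -subv0; apply/subvP => x.
by rewrite memK // => /(phi_free3 r0 r21 q1) ->; rewrite mem0v.
Qed.

(** * Conclusions from the nonvanishing of the quantum integers *)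

Section QuantumIntegers.
Variables (F : fieldType) (r : F) (n : nat).
Hypotheses (r_neq0 : r != 0) (r2_neq1 : r ^+ 2 != 1) (n_ge4 : (4 <= n)%N).
Hypothesis qint_neq0 : forall k, (0 < k <= n)%N -> qint (r ^+ 2) k != 0.

Lemma one_add_sqr_neq0 : 1 + r ^+ 2 != 0.
Proof.
have := @qint_neq0 2; rewrite /qint big_ord_recl big_ord1 expr0 expr1; apply; lia.
Qed.

Lemma K_unique_qint p : (4 <= p <= n)%N -> unique_proper_invariant r r (K r r p).
Proof.
move=> pn; apply: K_unique => //; try (by apply: qint_neq0; lia); last lia.
exact: one_add_sqr_neq0.
Qed.

(** Since K(3) = 0, the decomposition of K(4) leaves only the span of the w_k^(4), where the factor
    r^(n-4) is 1. *)
Lemma K4_basis :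
  let w1 : LK F 4 :=
    (w F 4 1 4 - r^-1 *: w F 4 2 4) + (w F 4 2 3 - r *: w F 4 1 3) in
  let w2 : LK F 4 :=
    (w F 4 2 4 - r^-1 *: w F 4 3 4) + (w F 4 1 3 - r *: w F 4 1 2) in
  free [:: w1; w2] /\ K r r 4 = <<[:: w1; w2]>>%VS.
Proof.
move=> w1 w2; have seqE : [seq wvec r 4 k | k <- iota 1 (4 - 2)] = [:: w1; w2].
  by rewrite /= /wvec /= expr0 !scale1r.
have q1_neq0 := one_add_sqr_neq0.
rewrite -seqE; split; first exact: free_wvec.
by rewrite K_decomp // K3_eq0 // limg0 add0v.
Qed.

Lemma K_decomp_pred : (5 <= n)%N ->
  [/\ K r r n = (LK_incl F n.-1 n @: K r r n.-1 + wspan r n)%VS,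
      directv (LK_incl F n.-1 n @: K r r n.-1 + wspan r n)
    & \dim (wspan r n) = (n - 2)%N].
Proof.
have q1_neq0 := one_add_sqr_neq0.
case: n n_ge4 => // p _ p_ge4; rewrite [p.+1.-1]/=; have p_ge3 : (3 <= p)%N by lia.
split; [exact: K_decomp | | exact: dim_wspan].
by apply/directv_addP; apply: lk_incl_wspan.
Qed.

End QuantumIntegers.

Lemma genr_sqr_neq1 (C : fieldType) (l r : C) :
  r ^+ 2 != 1 -> genr l r ^+ 2 != 1.
Proof.
by apply: contraNneq => /(congr1 val); rewrite rmorphXn rmorph1 => /eqP.
Qed.

Theorem theorem6 (R : realType) (l r : R[i]) (n : nat)
    (l_neq0 : l != 0) (r_neq0 : r != 0) (r2_neq1 : r ^+ 2 != 1)
    (l_eq_r : l = r) (n_ge4 : (4 <= n)%N)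
    (H_semisimple : semisimple (hecke (genr l r) n)) :
  let F : fieldType := gen_subfield l r in
  let lF : F := genl l r in
  let rF : F := genr l r in
  (n = 4%N ->
     let w1 : LK F 4 :=
       (w F 4 1 4 - rF^-1 *: w F 4 2 4) + (w F 4 2 3 - rF *: w F 4 1 3) in
     let w2 : LK F 4 :=
       (w F 4 2 4 - rF^-1 *: w F 4 3 4) + (w F 4 1 3 - rF *: w F 4 1 2) in
     [/\ unique_proper_invariant lF rF (K lF rF 4),
         free [:: w1; w2]
       & K lF rF 4 = <<[:: w1; w2]>>%VS]) /\
  ((5 <= n)%N ->
     [/\ unique_proper_invariant lF rF (K lF rF n),
         unique_proper_invariant lF rF (K lF rF n.-1),
         K lF rF n =
           (LK_incl F n.-1 n @: K lF rF n.-1 + wspan rF n)%VS,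
         directv (LK_incl F n.-1 n @: K lF rF n.-1 + wspan rF n)
       & \dim (wspan rF n) = (n - 2)%N]).
Proof.
move=> F lF rF; have lrF : lF = rF by apply: val_inj.
have rF_neq0 : rF != 0 by rewrite -val_eqE.
have rF2_neq1 : rF ^+ 2 != 1 by exact: genr_sqr_neq1.
have qint_neq0 k : (0 < k <= n)%N -> qint (rF ^+ 2) k != 0.
  exact: semisimple_qint_neq0.
(* From here F is an abstract field; the argument rests on rF != 0, rF^2 != 1 and the nonzero
   quantum integers. *)
clearbody lF rF; rewrite {lF}lrF; clearbody F; split=> [n4 w1 w2|n_ge5].
  have [w_free KE] := K4_basis rF_neq0 rF2_neq1 n_ge4 qint_neq0.
  by split=> //; apply: (K_unique_qint rF_neq0 rF2_neq1 n_ge4 qint_neq0); lia.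
have K_uniq := K_unique_qint rF_neq0 rF2_neq1 n_ge4 qint_neq0.
have [KE K_dir w_dim] := K_decomp_pred rF_neq0 rF2_neq1 n_ge4 qint_neq0 n_ge5.
by split=> //; apply: K_uniq; lia.
Qed.
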